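(* Let $f,g,h,L,\gamma$ satisfy the assumptions in the context, let $\varphi(x)=f(x)+g(x)+h(Lx)$ on $\mathbb{R}^n$, and let $\varphi^\gamma$ be the envelope defined in the context. Let $z^*$ be a critical point of $\varphi^{\gamma}$. If $h=0$ or $g=0$, then $z^*$ is a strict saddle point of $\varphi^{\gamma}$ if and only if $P_{\gamma g}(z^* )$ is a strict saddle point of $\varphi$.
   Context: Notation. For $\xi:\mathbb{R}^n\to\mathbb{R}\cup\{\infty\}$ and $\gamma>0$: $P_{\gamma \xi}(z)=\arg\min_{u\in\mathbb{R}^n}\{\xi(u)+\frac{1}{2\gamma}\|u-z\|^2\}$ is the proximal mapping and $\xi^{\gamma}(z)=\inf_{u\in\mathbb{R}^n}\{\xi(u)+\frac{1}{2\gamma}\|z-u\|^2\}$ is the Moreau envelope. A function is $\beta$-weakly convex if adding $\frac{\beta}{2}\|\cdot\|^2$ makes it convex. ''$M$-Lipschitz differentiable'' means differentiable with $M$-Lipschitz gradient. $\|\cdot\|$ is the Euclidean norm (operator norm for $L$ and matrices), and $1/0=+\infty$. $x^*$ is a critical point of a function $\psi$ if $\psi$ is differentiable at $x^*$ and $\nabla\psi(x^* )=\mathbf{0}$. $x^*$ is a strict saddle point of $\psi$ if $\psi$ is twice differentiable at $x^*$, $x^*$ is a critical point of $\psi$, and $\lambda_{\min}[\nabla^2\psi(x^* )]<0$, where $\lambda_{\min}$ is the smallest eigenvalue. Assumptions. (i) $L:\mathbb{R}^n\to\mathbb{R}^m$ is linear; $g:\mathbb{R}^n\to\mathbb{R}$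 is $L_g$-Lipschitz differentiable; $h:\mathbb{R}^m\to\mathbb{R}$ is $L_h$-Lipschitz differentiable; $f:\mathbb{R}^n\to\mathbb{R}\cup\{\infty\}$ is proper and lower semicontinuous; $\gamma\in(0,\frac{1}{L_g+L_h\|L\|^2})$; and $f+\frac{1}{2\gamma'}\|\cdot\|^2$ is bounded below for every $\gamma'\in(0,\frac{1}{L_g+L_h\|L\|^2})$. (ii) $f$ is $\beta_f$-weakly convex, $\gamma\in(0,\frac{1}{\beta_f})$, and $g,h$ are twice continuously differentiable. (iii) There is $L_f>0$ with $\gamma\in(0,\frac1{L_f})$ such that for any critical point $z^*$ of $\varphi^\gamma$, $f$ is twice continuously differentiable in a neighbourhood of $P_{\gamma g}(z^* )$ and $\|\nabla^2 f(P_{\gamma g}(z^* ))\|\le L_f$. Envelope. With $q(z)=L^T\nabla h\big(LP_{\gamma g}(z)\big)$, $$\varphi^{\gamma}(z) = g^{\gamma}(z)-\gamma \|\nabla g^{\gamma}(z)\|^2-\gamma \langle q(z), \nabla g^{\gamma}(z)\rangle +h\big(LP_{\gamma g}(z)\big)-\frac{\gamma}{2}\|q(z)\|^2 +f^{\gamma}\big(z-2\gamma \nabla g^{\gamma}(z)-\gamma q(z)\big).$$ *)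

(* Defs.v *)
(* Vectors of R^n are row vectors 'rV[R]_n.  The library's
   norm `|x| on 'rV[R]_n is the sup norm: it is used only through its topology
   (differentiability, continuity, neighbourhoods), which is the Euclidean one.
   All metric quantities go through [enorm]. *)
From HB Require Import structures.
From mathcomp Require Export all_boot all_order all_algebra.
From mathcomp Require Export all_classical all_reals all_analysis.
Export Order.TTheory GRing.Theory Num.Theory.
Export numFieldNormedType.Exports.

Set Implicit Arguments.
Unset Strict Implicit.
Unset Printing Implicit Defensive.

Local Open Scope classical_set_scope.
Local Open Scope ring_scope.

Section Euclidean.
Context {R : realType}.

Definition dotv n (u v : 'rV[R]_n) : R := \sum_(i < n) u 0 i * v 0 i.

Definition enorm n (u : 'rV[R]_n) : R := Num.sqrt (dotv u u).

(* Applied to linear maps; a matrix A is passed as the map u |-> u *m A. *)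
Definition opnorm n m (F : 'rV[R]_n -> 'rV[R]_m) : R :=
  sup [set enorm (F u) | u in [set u | enorm u <= 1]].

(* [lin1_mx F] is the matrix A such that F u = u *m A. *)
Definition adjoint n m (F : 'rV[R]_n -> 'rV[R]_m) (v : 'rV[R]_m) : 'rV[R]_n :=
  v *m (lin1_mx F)^T.

(* The infimum is a minimum for a symmetric matrix of positive size, whose set
   of eigenvalues is finite and nonempty. *)
Definition lambda_min n (A : 'M[R]_n) : R := inf [set a | eigenvalue A a].

End Euclidean.

Section Smooth.
Context {R : realType} {n : nat}.
Implicit Types (f : 'rV[R]_n -> R) (psi : 'rV[R]_n -> \bar R) (x : 'rV[R]_n).

Definition grad f x : 'rV[R]_n := \row_(i < n) 'D_(delta_mx 0 i) f x.

Definition hessian f x : 'M[R]_n := jacobian (grad f) x.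

Definition twice_differentiable_at f x : Prop :=
  (\forall y \near x, differentiable f y) /\ differentiable (grad f) x.

(* Meant for open A. *)
Definition C2_on (A : set 'rV[R]_n) f : Prop :=
  forall x, A x -> twice_differentiable_at f x /\ {for x, continuous (hessian f)}.

Definition lipschitz_differentiable (M : R) f : Prop :=
  [/\ 0 <= M, forall x, differentiable f x
    & forall x y, enorm (grad f x - grad f y) <= M * enorm (x - y)].

(* An extended-valued function is (twice) differentiable at a point when it is
   finite near that point and its real part [fine \o psi] is (twice)
   differentiable there. *)
Definition finite_near psi x : Prop := \forall y \near x, psi y \is a fin_num.

Definition critical_point psi x : Prop :=
  [/\ finite_near psi x, differentiable (fine \o psi) x
    & grad (fine \o psi) x = 0].

Definition strict_saddle psi x : Prop :=
  [/\ finite_near psi x, twice_differentiable_at (fine \o psi) x,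
      critical_point psi x & lambda_min (hessian (fine \o psi) x) < 0].

Definition C2_near psi x : Prop :=
  exists2 U, open_nbhs x U &
    (forall y, U y -> psi y \is a fin_num) /\ C2_on U (fine \o psi).

End Smooth.

Section Proximal.
Context {R : realType} {n : nat}.
Local Open Scope ereal_scope.
Implicit Types (xi : 'rV[R]_n -> \bar R) (z u : 'rV[R]_n) (gamma : R).

Definition proper xi : Prop := (forall x, -oo < xi x) /\ exists x, xi x < +oo.

(* In \bar R, 0 * +oo = 0, so t = 0 and t = 1 add nothing. *)
Definition econvex xi : Prop :=
  forall (x y : 'rV[R]_n) (t : R), (0 <= t <= 1)%R ->
    xi (t *: x + (1 - t) *: y)%R <= t%:E * xi x + (1 - t)%:E * xi y.

Definition weakly_convex (beta : R) xi : Prop :=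
  econvex (fun x => xi x + (beta / 2 * enorm x ^+ 2)%:E).

Definition bounded_below xi : Prop := exists c : R, forall x, c%:E <= xi x.

Definition prox_objective gamma xi z u : \bar R :=
  xi u + ((2 * gamma)^-1 * enorm (u - z) ^+ 2)%:E.

Definition argmin (F : 'rV[R]_n -> \bar R) : set 'rV[R]_n :=
  [set u | forall v, F u <= F v].

(* A selection of the argmin set; it is applied below only where the minimizer
   is unique. *)
Definition prox gamma xi z : 'rV[R]_n := xget 0%R (argmin (prox_objective gamma xi z)).

Definition moreau gamma xi z : \bar R :=
  ereal_inf (range (prox_objective gamma xi z)).

End Proximal.

Section Envelope.
Context {R : realType} {n m : nat}.
Variables (f : 'rV[R]_n -> \bar R) (g : 'rV[R]_n -> R) (h : 'rV[R]_m -> R).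
Variables (L : 'rV[R]_n -> 'rV[R]_m) (gamma : R).

Definition objective (x : 'rV[R]_n) : \bar R :=
  (f x + (g x)%:E + (h (L x))%:E)%E.

Definition envelope (z : 'rV[R]_n) : \bar R :=
  let p := prox gamma (EFin \o g) z in
  let dg := grad (fine \o moreau gamma (EFin \o g)) z in
  let q := adjoint L (grad h (L p)) in
  (moreau gamma (EFin \o g) z
   + (- gamma * enorm dg ^+ 2 - gamma * dotv q dg
      + h (L p) - gamma / 2 * enorm q ^+ 2)%R%:E
   + moreau gamma f (z - (2 * gamma) *: dg - gamma *: q)%R)%E.

End Envelope.

(* Main.v *)
From HB Require Import structures.
From mathcomp Require Import ring lra.
Require Import Defs.

Set Implicit Arguments.
Unset Strict Implicit.
Unset Printing Implicit Defensive.

Local Open Scope classical_set_scope.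
Local Open Scope ring_scope.

(** Let S = g + h o L be the smooth part of the objective, and let P and Q be the
    proximal mappings of g and f.  Since z = P z + gamma grad g (P z), the
    envelope is a forward-backward envelope read in the coordinate x = P z
    ([envelope_fbe]):

      phi^gamma (z) = Phi (P z),
      Phi x = S x - gamma/2 |grad S x|^2 + f^gamma (x - gamma grad S x).

    Moreau envelopes of weakly convex functions are differentiable
    ([has_grad_moreau]), and this gives ([has_grad_fbe])

      grad Phi x = G x (1 - gamma Hess S x),
      G x = gamma^-1 (x - Q (x - gamma grad S x)).

    The bound on gamma makes 1 - gamma Hess S positive definite and P a change of
    variables whose derivative at z is the inverse of J = 1 + gamma Hess g (P z)
    ([has_jac_prox]).  Hence z is a critical point exactly when G vanishes at
    p = P z, that is, when p = Q (p - gamma grad S p); in that case p is critical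
    for the objective.

    At such a point f is C2 near p, so the derivative of Q at p - gamma grad S p is
    the inverse of N = 1 + gamma Hess f (p).  Write M = 1 - gamma Hess S (p).
    Because G vanishes at p, the gradient G (P z) M (P z) J^-1 of the envelope is
    differentiable at z although its last two factors are only continuous
    ([has_jac_mulmx0], [has_jac_divmx0]), and only G contributes to the derivative:

      Hess phi^gamma (z) = gamma^-1 J^-1 (M - M N^-1 M) J^-1,
      Hess phi (p) = gamma^-1 (N - M).

    The matrices M - M N^-1 M and N - M are the two Schur complements of one block
    matrix with positive definite diagonal blocks M and N, so that one of their
    quadratic forms takes a negative value if and only if the other does
    ([schur_qform_lt0]).  The Hessians are symmetric ([hessian_sym]), and for a
    symmetric matrix a negative value of the quadratic form means a negative
    smallest eigenvalue ([lambda_min_lt0]). *)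

(** * The Euclidean inner product and norm *)

Section EuclideanNorm.
Context {R : realType}.
Implicit Types n m : nat.

Lemma dotvE n (u v : 'rV[R]_n) : dotv u v = (u *m v^T) 0 0.
Proof. by rewrite /dotv mxE; apply: eq_bigr => i _; rewrite mxE. Qed.

Lemma dotvC n (u v : 'rV[R]_n) : dotv u v = dotv v u.
Proof. by apply: eq_bigr => i _; rewrite mulrC. Qed.

Lemma dotvDl n (u v w : 'rV[R]_n) : dotv (u + v) w = dotv u w + dotv v w.
Proof. by rewrite !dotvE mulmxDl mxE. Qed.

Lemma dotvZl n a (u w : 'rV[R]_n) : dotv (a *: u) w = a * dotv u w.
Proof. by rewrite !dotvE -scalemxAl mxE. Qed.

Lemma dotvNl n (u w : 'rV[R]_n) : dotv (- u) w = - dotv u w.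
Proof. by rewrite -scaleN1r dotvZl mulN1r. Qed.

Lemma dotvBl n (u v w : 'rV[R]_n) : dotv (u - v) w = dotv u w - dotv v w.
Proof. by rewrite dotvDl dotvNl. Qed.

Lemma dotvDr n (u v w : 'rV[R]_n) : dotv w (u + v) = dotv w u + dotv w v.
Proof. by rewrite dotvC dotvDl !(dotvC w). Qed.

Lemma dotvZr n a (u w : 'rV[R]_n) : dotv w (a *: u) = a * dotv w u.
Proof. by rewrite dotvC dotvZl (dotvC w). Qed.

Lemma dotvNr n (u w : 'rV[R]_n) : dotv w (- u) = - dotv w u.
Proof. by rewrite dotvC dotvNl (dotvC w). Qed.

Lemma dotvBr n (u v w : 'rV[R]_n) : dotv w (u - v) = dotv w u - dotv w v.
Proof. by rewrite dotvDr dotvNr. Qed.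

Lemma dot0v n (u : 'rV[R]_n) : dotv 0 u = 0.
Proof. by rewrite -(scale0r 0) dotvZl mul0r. Qed.

Lemma dotv0 n (u : 'rV[R]_n) : dotv u 0 = 0.
Proof. by rewrite dotvC dot0v. Qed.

Definition dotv_lin := (dotvDl, dotvDr, dotvNl, dotvNr, dotvZl, dotvZr).

Lemma dotv_mulmx n m (u : 'rV[R]_n) (A : 'M[R]_(n, m)) (v : 'rV[R]_m) :
  dotv (u *m A) v = dotv u (v *m A^T).
Proof. by rewrite !dotvE trmx_mul trmxK mulmxA. Qed.

Lemma dotvv_ge0 n (u : 'rV[R]_n) : 0 <= dotv u u.
Proof. by apply: sumr_ge0 => i _; rewrite -expr2 sqr_ge0. Qed.

Lemma dotvv_eq0 n (u : 'rV[R]_n) : (dotv u u == 0) = (u == 0).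
Proof.
apply/idP/eqP => [|->]; last by rewrite dot0v.
rewrite psumr_eq0 => [/allP u0|i _]; last by rewrite -expr2 sqr_ge0.
apply/rowP => i; rewrite mxE; apply/eqP.
by have := u0 i (mem_index_enum _); rewrite -expr2 sqrf_eq0.
Qed.

Lemma dotvv_gt0 n (u : 'rV[R]_n) : (0 < dotv u u) = (u != 0).
Proof. by rewrite lt0r dotvv_ge0 dotvv_eq0 andbT. Qed.

Lemma dotv_delta n (u : 'rV[R]_n) i : dotv u (delta_mx 0 i) = u 0 i.
Proof.
rewrite /dotv (bigD1 i)//= big1 => [|j ji]; rewrite !mxE ?eqxx ?mulr1 ?addr0//.
by rewrite (negPf ji) andbF mulr0.
Qed.

Lemma dotv_inj n (u v : 'rV[R]_n) : dotv u = dotv v -> u = v.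
Proof. by move=> uv; apply/rowP => i; rewrite -!dotv_delta uv. Qed.

Lemma enorm_ge0 n (u : 'rV[R]_n) : 0 <= enorm u.
Proof. exact: sqrtr_ge0. Qed.

Lemma enorm_sqr n (u : 'rV[R]_n) : enorm u ^+ 2 = dotv u u.
Proof. by rewrite sqr_sqrtr// dotvv_ge0. Qed.

Lemma enorm_eq0 n (u : 'rV[R]_n) : (enorm u == 0) = (u == 0).
Proof. by rewrite -sqrf_eq0 enorm_sqr dotvv_eq0. Qed.

Lemma enorm0 n : enorm (0 : 'rV[R]_n) = 0.
Proof. by apply/eqP; rewrite enorm_eq0. Qed.

Lemma enorm_gt0 n (u : 'rV[R]_n) : (0 < enorm u) = (u != 0).
Proof. by rewrite lt0r enorm_ge0 enorm_eq0 andbT. Qed.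

Lemma enormZ n a (u : 'rV[R]_n) : enorm (a *: u) = `|a| * enorm u.
Proof.
by rewrite /enorm dotvZl dotvZr mulrA -expr2 sqrtrM ?sqr_ge0// sqrtr_sqr.
Qed.

Lemma enormN n (u : 'rV[R]_n) : enorm (- u) = enorm u.
Proof. by rewrite -scaleN1r enormZ normrN1 mul1r. Qed.

Lemma enorm_distC n (u v : 'rV[R]_n) : enorm (u - v) = enorm (v - u).
Proof. by rewrite -opprB enormN. Qed.

Lemma dotv_le_enorm n (u v : 'rV[R]_n) : dotv u v <= enorm u * enorm v.
Proof.
have [->|u0] := eqVneq u 0; first by rewrite dot0v enorm0 mul0r.
have [->|v0] := eqVneq v 0; first by rewrite dotv0 enorm0 mulr0.
have uv : 0 < enorm u * enorm v by rewrite mulr_gt0 ?enorm_gt0.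
have := dotvv_ge0 (enorm v *: u - enorm u *: v).
rewrite !dotv_lin (dotvC v u) -!enorm_sqr.
set a := enorm u in uv *; set b := enorm v in uv *; set d := dotv u v => h.
by rewrite -(ler_pM2l uv); nra.
Qed.

Lemma normr_dotv_le n (u v : 'rV[R]_n) : `|dotv u v| <= enorm u * enorm v.
Proof.
rewrite ler_norml dotv_le_enorm andbT lerNl -dotvNl -(enormN u).
exact: dotv_le_enorm.
Qed.

Lemma enormD n (u v : 'rV[R]_n) : enorm (u + v) <= enorm u + enorm v.
Proof.
rewrite -(@ler_sqr _ (enorm (u + v))) ?nnegrE ?addr_ge0 ?enorm_ge0//.
rewrite enorm_sqr !dotv_lin (dotvC v u) sqrrD !enorm_sqr.
by have := dotv_le_enorm u v; lra.
Qed.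

Lemma enormB n (u v : 'rV[R]_n) : enorm (u - v) <= enorm u + enorm v.
Proof. by rewrite -(enormN v) enormD. Qed.

Lemma coord_le_enorm n (u : 'rV[R]_n) i : `|u 0 i| <= enorm u.
Proof.
rewrite -(@ler_sqr _ `|_|) ?nnegrE ?enorm_ge0// enorm_sqr real_normK ?num_real//.
rewrite /dotv (bigD1 i)//= -expr2 lerDl sumr_ge0// => j _.
by rewrite -expr2 sqr_ge0.
Qed.

Lemma enorm_le_sum n (u : 'rV[R]_n) : enorm u <= \sum_(i < n) `|u 0 i|.
Proof.
rewrite -(@ler_sqr _ (enorm u)) ?nnegrE ?enorm_ge0 ?sumr_ge0//.
rewrite enorm_sqr /dotv [leRHS]expr2 mulr_suml; apply: ler_sum => i _.
rewrite -expr2 -real_normK ?num_real// expr2 ler_wpM2l//.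
by rewrite (bigD1 i)//= lerDl sumr_ge0.
Qed.

Lemma mx_norm_coord n m (A : 'M[R]_(n, m)) i j : `|A i j| <= `|A|.
Proof.
rewrite [leRHS]/Num.norm /= mx_normrE.
by apply/bigmax_geP; right => /=; exists (i, j).
Qed.

Lemma norm_le_enorm n (u : 'rV[R]_n) : `|u| <= enorm u.
Proof.
rewrite [leLHS]/Num.norm /= mx_normrE; apply: bigmax_le; first exact: enorm_ge0.
by move=> [i j] _ /=; rewrite (ord1 i) coord_le_enorm.
Qed.

Lemma enorm_le_norm n (u : 'rV[R]_n) : enorm u <= n%:R * `|u|.
Proof.
apply: le_trans (enorm_le_sum _) _.
have -> : n%:R * `|u| = \sum_(i < n) `|u|.
  by rewrite sumr_const card_ord mulr_natl.
by apply: ler_sum => i _; exact: mx_norm_coord.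
Qed.

Lemma enorm_mulmx_norm n m (u : 'rV[R]_n) (A : 'M[R]_(n, m)) :
  enorm (u *m A) <= (m * n)%:R * `|A| * enorm u.
Proof.
apply: le_trans (enorm_le_sum _) _.
have -> : (m * n)%:R * `|A| * enorm u =
    \sum_(j < m) \sum_(i < n) (`|A| * enorm u).
  by rewrite !sumr_const !card_ord -mulrnA -mulrA -[RHS]mulr_natl mulnC.
apply: ler_sum => j _; rewrite mxE.
apply: le_trans (ler_norm_sum _ _ _) _; apply: ler_sum => i _.
by rewrite normrM mulrC ler_pM// ?mx_norm_coord ?coord_le_enorm.
Qed.

Lemma enorm_mulmx_bounded n m (A : 'M[R]_(n, m)) :
  exists2 C, 0 < C & forall u, enorm (u *m A) <= C * enorm u.
Proof.
exists ((m * n)%:R * `|A| + 1); first by rewrite ltr_wpDl// mulr_ge0.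
move=> u; apply: le_trans (enorm_mulmx_norm _ _) _.
by rewrite ler_wpM2r ?enorm_ge0// lerDl.
Qed.

(** The sup norm and the Euclidean norm are equivalent, so neighbourhoods can
    be described by Euclidean balls. *)
Lemma near_enormP n (x : 'rV[R]_n) (Q : 'rV[R]_n -> Prop) :
  (\forall y \near x, Q y) <->
  exists2 d, 0 < d & forall y, enorm (y - x) < d -> Q y.
Proof.
split=> [/nbhs_normP[d /= d0 dQ]|[d d0 dQ]].
  exists d => // y yx; apply: dQ => /=; rewrite distrC.
  exact: le_lt_trans (norm_le_enorm _) yx.
apply/nbhs_normP; exists (d / (n%:R + 1)) => /=.
  by rewrite divr_gt0// ltr_wpDl.
move=> y /=; rewrite distrC => yx; apply: dQ.
apply: le_lt_trans (enorm_le_norm _) _.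
apply: (@le_lt_trans _ _ ((n%:R + 1) * `|y - x|)).
  by rewrite ler_wpM2r// lerDl.
by rewrite mulrC -ltr_pdivlMr// ltr_wpDl.
Qed.

Lemma near_enorm_lt n (x : 'rV[R]_n) d :
  0 < d -> \forall y \near x, enorm (y - x) < d.
Proof. by move=> d0; apply/near_enormP; exists d. Qed.

Lemma enorm_continuous_at n m (F : 'rV[R]_n -> 'rV[R]_m) x :
  (forall e, 0 < e -> \forall y \near x, enorm (F y - F x) < e) ->
  {for x, continuous F}.
Proof.
move=> Fx; apply/(@cvgrPdist_lt _ _ _ (nbhs x)) => e e0; near=> y.
rewrite distrC; apply: le_lt_trans (norm_le_enorm _) _.
by near: y; exact: Fx.
Unshelve. all: by end_near. Qed.

Lemma lipschitz_continuous_at n m (F : 'rV[R]_n -> 'rV[R]_m) x c :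
  (forall y, enorm (F y - F x) <= c * enorm (y - x)) -> {for x, continuous F}.
Proof.
move=> Fc; apply: enorm_continuous_at => e e0; near=> y.
apply: (@le_lt_trans _ _ ((`|c| + 1) * enorm (y - x))).
  apply: le_trans (Fc y) _; rewrite ler_wpM2r ?enorm_ge0//.
  by rewrite (le_trans (ler_norm _))// lerDl.
rewrite mulrC -ltr_pdivlMr ?ltr_wpDl//; near: y; apply: near_enorm_lt.
by rewrite divr_gt0// ltr_wpDl.
Unshelve. all: by end_near. Qed.

Lemma continuous_enorm_at n (z : 'rV[R]_n) :
  continuous (fun u : 'rV[R]_n => enorm (u - z)).
Proof.
move=> x; apply/(@cvgrPdist_lt _ _ _ (nbhs x)) => e e0; near=> y.
have : enorm (y - x) < e by near: y; exact: near_enorm_lt.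
apply: le_lt_trans; rewrite ler_norml.
have := enormD (y - x) (x - z); have := enormD (x - y) (y - z).
by rewrite !addrA !subrK (enorm_distC x y); lra.
Unshelve. all: by end_near. Qed.

End EuclideanNorm.

(** * Operator norm *)

Section OperatorNorm.
Context {R : realType}.

Let unit_ball_bounded n m (F : {linear 'rV[R]_n -> 'rV[R]_m}) :
  has_ubound [set enorm (F u) | u in [set u | enorm u <= 1]].
Proof.
have [C C0 hC] := enorm_mulmx_bounded (lin1_mx F).
exists C => _ [v /= v1 <-]; rewrite -mul_rV_lin1.
by apply: le_trans (hC v) _; rewrite ler_piMr// ltW.
Qed.

Lemma opnorm_ub n m (F : {linear 'rV[R]_n -> 'rV[R]_m}) u :
  enorm (F u) <= opnorm F * enorm u.
Proof.
have [->|u0] := eqVneq u 0; first by rewrite linear0 !enorm0 mulr0.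
have eu0 : 0 < enorm u by rewrite enorm_gt0.
rewrite -ler_pdivrMr// mulrC -[(enorm u)^-1]gtr0_norm ?invr_gt0//.
rewrite -enormZ -linearZ; apply: sup_ubound.
  exact: unit_ball_bounded.
exists ((enorm u)^-1 *: u) => //=.
by rewrite enormZ gtr0_norm ?invr_gt0// mulVf ?gt_eqF.
Qed.

Lemma opnorm_ge0 n m (F : {linear 'rV[R]_n -> 'rV[R]_m}) : 0 <= opnorm F.
Proof.
apply: sup_ubound; first exact: unit_ball_bounded.
by exists 0 => /=; rewrite ?linear0 ?enorm0.
Qed.

Lemma enorm_adjoint_le n m (F : {linear 'rV[R]_n -> 'rV[R]_m}) v :
  enorm (adjoint F v) <= opnorm F * enorm v.
Proof.
set w := adjoint F v.
have [->|w0] := eqVneq w 0; first by rewrite enorm0 mulr_ge0 ?opnorm_ge0 ?enorm_ge0.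
have ew0 : 0 < enorm w by rewrite enorm_gt0.
rewrite -(ler_pM2r ew0) -expr2 enorm_sqr {1}/w /adjoint dotv_mulmx trmxK.
rewrite mul_rV_lin1 mulrAC; apply: le_trans (dotv_le_enorm _ _) _.
by rewrite mulrC ler_wpM2r ?enorm_ge0// opnorm_ub.
Qed.

End OperatorNorm.

(** * Gradients and Jacobian matrices *)

Section Derivatives.
Context {R : realType}.

HB.instance Definition _ n (a : 'rV[R]_n) :=
  GRing.isLinear.Build R 'rV[R]_n R *:%R (dotv a)
    (fun k u v => etrans (dotvDr _ _ _) (congr1 (+%R^~ _) (dotvZr k u a))).

Definition has_jac n m (F : 'rV[R]_n -> 'rV[R]_m) x (A : 'M[R]_(n, m)) :=
  is_diff x F (mulmxr A).

Definition has_grad n (f : 'rV[R]_n -> R) x (a : 'rV[R]_n) :=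
  is_diff x f (dotv a).

Lemma is_diff_enormP n (W : normedModType R) (F : 'rV[R]_n -> W) x
    (dF : {linear 'rV[R]_n -> W}) : continuous dF ->
  is_diff x F dF <-> forall e, 0 < e ->
    \forall y \near x, `|F y - F x - dF (y - x)| <= e * enorm (y - x).
Proof.
move=> cdF; split=> [[dFx dFE] e e0|Fx].
  have [_ /eqaddoP/(_ _ e0)] := (diff_locallyP _ _).1 dFx.
  rewrite [X in X -> _](near_shift x) sub0r => h.
  near=> y.
  have : `|((F \o shift x) - (cst (F x) + 'd F x)) (y - x)| <= e * `|y - x|.
    by near: y; exact: h.
  rewrite dFE /= /cst !fctE/= subrK opprD addrA => /le_trans; apply.
  by rewrite ler_wpM2l ?norm_le_enorm// ltW.
have dFE : F \o shift x = cst (F x) + dF +o_ 0 id.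
  apply/eqaddoP => e e0; rewrite [\forall h \near _, _ <= _](near_shift x) sub0r.
  have ne0 : 0 < e / (n%:R + 1) by rewrite divr_gt0// ltr_wpDl.
  near=> y; rewrite /= !fctE/= subrK opprD addrA.
  apply: (@le_trans _ _ (e / (n%:R + 1) * enorm (y - x))).
    by near: y; exact: Fx.
  rewrite -mulrA ler_pM2l// ler_pdivrMl ?ltr_wpDl//.
  by apply: le_trans (enorm_le_norm _) _; rewrite ler_wpM2r// lerDl.
have dE := diff_unique cdF dFE.
by split=> //; apply/diff_locallyP; rewrite dE.
Unshelve. all: by end_near. Qed.

Lemma linear_rV_continuous n m (A : 'M[R]_(n, m)) :
  continuous (mulmxr A : 'rV[R]_n -> 'rV[R]_m).
Proof.
move=> x; apply: enorm_continuous_at => e e0.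
have [C C0 hC] := enorm_mulmx_bounded A.
near=> y; rewrite -linearB /=; apply: le_lt_trans (hC _) _.
rewrite mulrC -ltr_pdivlMr//; near: y; apply: near_enorm_lt.
by rewrite divr_gt0.
Unshelve. all: by end_near. Qed.

Lemma dotv_continuous n (a : 'rV[R]_n) : continuous (dotv a).
Proof.
move=> x; apply/(@cvgrPdist_lt _ _ _ (nbhs x)) => e e0.
have c0 : 0 < enorm a + 1 by rewrite ltr_wpDl// enorm_ge0.
near=> y; rewrite distrC -dotvBr; apply: le_lt_trans (normr_dotv_le _ _) _.
apply: (@le_lt_trans _ _ ((enorm a + 1) * enorm (y - x))).
  by rewrite ler_wpM2r ?enorm_ge0// lerDl.
rewrite mulrC -ltr_pdivlMr//; near: y; apply: near_enorm_lt.
by rewrite divr_gt0.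
Unshelve. all: by end_near. Qed.

Lemma has_jacP n m (F : 'rV[R]_n -> 'rV[R]_m) x A :
  has_jac F x A <-> forall e, 0 < e ->
    \forall y \near x, enorm (F y - F x - (y - x) *m A) <= e * enorm (y - x).
Proof.
split=> [/(is_diff_enormP _ _ (@linear_rV_continuous _ _ A)) Fx e e0|Fx].
  have me0 : 0 < e / (m%:R + 1) by rewrite divr_gt0// ltr_wpDl.
  near=> y.
  apply: (@le_trans _ _ ((m%:R + 1) * (e / (m%:R + 1) * enorm (y - x)))).
    apply: le_trans (enorm_le_norm _) _; rewrite ler_pM ?lerDl//.
    by near: y; exact: Fx.
  by rewrite mulrA mulrCA mulfV ?mulr1// gt_eqF// ltr_wpDl.
apply/(is_diff_enormP _ _ (@linear_rV_continuous _ _ A)) => e e0; near=> y.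
apply: le_trans (norm_le_enorm _) _.
by near: y; exact: Fx.
Unshelve. all: by end_near. Qed.

Lemma has_gradP n (f : 'rV[R]_n -> R) x a :
  has_grad f x a <-> forall e, 0 < e ->
    \forall y \near x, `|f y - f x - dotv a (y - x)| <= e * enorm (y - x).
Proof. exact/is_diff_enormP/dotv_continuous. Qed.

Lemma mulmx_rV_inj n m (A B : 'M[R]_(n, m)) :
  (forall u : 'rV_n, u *m A = u *m B) -> A = B.
Proof. by move=> AB; apply/row_matrixP => i; rewrite !rowE. Qed.

Lemma has_jacE n m (F : 'rV[R]_n -> 'rV[R]_m) x A :
  has_jac F x A -> jacobian F x = A.
Proof.
move=> [_ dF]; apply: mulmx_rV_inj => u.
by rewrite /jacobian mul_rV_lin1 dF.
Qed.

Lemma has_jac_diff n m (F : 'rV[R]_n -> 'rV[R]_m) x :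
  differentiable F x -> has_jac F x (jacobian F x).
Proof.
move=> dF; split=> //; apply/funext => u /=.
by rewrite /jacobian mul_rV_lin1.
Qed.

Lemma has_gradE n (f : 'rV[R]_n -> R) x a : has_grad f x a -> grad f x = a.
Proof.
move=> [df dfE]; apply/rowP => i.
by rewrite mxE deriveE// dfE dotv_delta.
Qed.

Lemma has_grad_diff n (f : 'rV[R]_n -> R) x :
  differentiable f x -> has_grad f x (grad f x).
Proof.
move=> df; split=> //; apply/funext => u.
rewrite [in LHS](row_sum_delta u) linear_sum; apply: eq_bigr => i _.
by rewrite linearZ mxE deriveE// mulrC.
Qed.

Lemma has_jac_continuous n m (F : 'rV[R]_n -> 'rV[R]_m) x A :
  has_jac F x A -> {for x, continuous F}.
Proof. by move=> [dF _]; exact: differentiable_continuous. Qed.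

Lemma near_eq_has_jac n m (F G : 'rV[R]_n -> 'rV[R]_m) x A :
  (\forall y \near x, F y = G y) -> has_jac F x A -> has_jac G x A.
Proof.
move=> FG /has_jacP Fx; apply/has_jacP => e e0; near=> y.
have <- : F x = G x by exact: nbhs_singleton FG.
have <- : F y = G y by near: y.
by near: y; exact: Fx.
Unshelve. all: by end_near. Qed.

Lemma near_eq_has_grad n (f g : 'rV[R]_n -> R) x a :
  (\forall y \near x, f y = g y) -> has_grad f x a -> has_grad g x a.
Proof.
move=> fg /has_gradP fx; apply/has_gradP => e e0; near=> y.
have <- : f x = g x by exact: nbhs_singleton fg.
have <- : f y = g y by near: y.
by near: y; exact: fx.
Unshelve. all: by end_near. Qed.

Lemma has_jacD n m (F G : 'rV[R]_n -> 'rV[R]_m) x A B :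
  has_jac F x A -> has_jac G x B -> has_jac (fun y => F y + G y) x (A + B).
Proof.
move=> FA GB; apply: (is_diff_eq (is_diffD FA GB)).
by apply/funext => u /=; rewrite fctE mulmxDr.
Qed.

Lemma has_jacZ n m k (F : 'rV[R]_n -> 'rV[R]_m) x A :
  has_jac F x A -> has_jac (fun y => k *: F y) x (k *: A).
Proof.
move=> FA; apply: (is_diff_eq (is_diffZ k FA)).
by apply/funext => u /=; rewrite fctE scalemxAr.
Qed.

Lemma has_jacB n m (F G : 'rV[R]_n -> 'rV[R]_m) x A B :
  has_jac F x A -> has_jac G x B -> has_jac (fun y => F y - G y) x (A - B).
Proof.
move=> FA GB; apply: (is_diff_eq (is_diffB FA GB)).
by apply/funext => u /=; rewrite fctE mulmxBr.
Qed.

Lemma has_jac_id n (x : 'rV[R]_n) : has_jac id x 1%:M.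
Proof.
apply: (is_diff_eq (is_diff_id x)).
by apply/funext => u /=; rewrite mulmx1.
Qed.

Lemma has_jac_mulmx n m (A : 'M[R]_(n, m)) (x : 'rV[R]_n) :
  has_jac (mulmxr A) x A.
Proof.
have cA := @linear_rV_continuous _ _ A.
split; first exact: (linear_differentiable x cA).
exact: (diff_lin x cA).
Qed.

Lemma has_jac_comp n m p (F : 'rV[R]_n -> 'rV[R]_m) (G : 'rV[R]_m -> 'rV[R]_p)
    x A B :
  has_jac F x A -> has_jac G (F x) B -> has_jac (fun y => G (F y)) x (A *m B).
Proof.
move=> FA GB; apply: (is_diff_eq (is_diff_comp FA GB)).
by apply/funext => u /=; rewrite mulmxA.
Qed.

Lemma has_grad_comp n m (F : 'rV[R]_n -> 'rV[R]_m) (g : 'rV[R]_m -> R) x A a :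
  has_jac F x A -> has_grad g (F x) a ->
  has_grad (fun y => g (F y)) x (a *m A^T).
Proof.
move=> FA ga; apply: (is_diff_eq (is_diff_comp FA ga)).
by apply/funext => u /=; rewrite dotv_mulmx trmxK.
Qed.

Lemma has_gradD n (f g : 'rV[R]_n -> R) x a b :
  has_grad f x a -> has_grad g x b -> has_grad (fun y => f y + g y) x (a + b).
Proof.
move=> fa gb; apply: (is_diff_eq (is_diffD fa gb)).
by apply/funext => u; rewrite fctE dotvDl.
Qed.

Lemma has_gradB n (f g : 'rV[R]_n -> R) x a b :
  has_grad f x a -> has_grad g x b -> has_grad (fun y => f y - g y) x (a - b).
Proof.
move=> fa gb; apply: (is_diff_eq (is_diffB fa gb)).
by apply/funext => u; rewrite fctE dotvBl.
Qed.

Lemma has_gradZ n k (f : 'rV[R]_n -> R) x a :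
  has_grad f x a -> has_grad (fun y => k * f y) x (k *: a).
Proof.
move=> fa; apply: (is_diff_eq (is_diffZ k fa)).
by apply/funext => u; rewrite fctE dotvZl.
Qed.

Lemma has_grad_dotv n (a x : 'rV[R]_n) : has_grad (dotv a) x a.
Proof.
have ca := dotv_continuous (a := a).
split; first exact: (linear_differentiable x ca).
exact: (diff_lin x ca).
Qed.

Lemma has_grad_sqr n (x : 'rV[R]_n) : has_grad (fun y => dotv y y) x (2 *: x).
Proof.
apply/has_gradP => e e0; near=> y.
have -> : dotv y y - dotv x x - dotv (2 *: x) (y - x) = enorm (y - x) ^+ 2.
  by rewrite enorm_sqr !dotv_lin (dotvC y x); ring.
rewrite ger0_norm ?sqr_ge0// expr2 ler_wpM2r ?enorm_ge0// ltW//.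
by near: y; exact: near_enorm_lt.
Unshelve. all: by end_near. Qed.

Lemma has_jac_shift n (b x : 'rV[R]_n) : has_jac (fun y => y + b) x 1%:M.
Proof.
apply/has_jacP => e e0; near=> y.
rewrite mulmx1 opprD addrACA subrr addr0 subrr enorm0.
by rewrite mulr_ge0 ?enorm_ge0// ltW.
Unshelve. all: by end_near. Qed.

Lemma has_grad_sqr_dist n (b x : 'rV[R]_n) :
  has_grad (fun y => dotv (y - b) (y - b)) x (2 *: (x - b)).
Proof.
have := has_grad_comp (has_jac_shift (- b) x) (has_grad_sqr (x - b)).
by rewrite trmx1 mulmx1.
Qed.

Lemma local_min_has_grad n (f : 'rV[R]_n -> R) x a :
  has_grad f x a -> (\forall y \near x, f x <= f y) -> a = 0.
Proof.
move=> /has_gradP fa fx; apply: contrapT => /eqP a0.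
have ea : 0 < enorm a by rewrite enorm_gt0.
have : \forall y \near x,
    f x <= f y /\ `|f y - f x - dotv a (y - x)| <= enorm a / 2 * enorm (y - x).
  by apply: filterI => //; apply: fa; rewrite divr_gt0.
move=> /near_enormP[d d0 hd].
pose t := d / (2 * enorm a).
have t0 : 0 < t by rewrite divr_gt0// mulr_gt0.
have ta : t * enorm a = d / 2 by rewrite /t; field; rewrite gt_eqF.
have [] := hd (x - t *: a).
  by rewrite addrAC subrr add0r enormN enormZ gtr0_norm// ta; lra.
rewrite [x - _ - x]addrAC subrr add0r dotvNr dotvZr -enorm_sqr enormN enormZ.
rewrite (gtr0_norm t0) ler_norml => fle /andP[_ ].
have : 0 < t * enorm a ^+ 2 by rewrite mulr_gt0// exprn_gt0.
by move: fle; nra.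
Qed.

(** Mean value theorem along a segment. *)
Lemma mvt_segment n (f : 'rV[R]_n -> R) (x d : 'rV[R]_n) :
  (forall t : R, 0 <= t <= 1 -> differentiable f (x + t *: d)) ->
  exists2 t : R, 0 < t < 1 & f (x + d) - f x = dotv (grad f (x + t *: d)) d.
Proof.
move=> df; pose phi (t : R) := f (x + t *: d).
have dphi (t : R) : 0 <= t <= 1 ->
    is_diff t phi (fun s => dotv (grad f (x + t *: d)) (s *: d)).
  move=> t01; have dl : is_diff t (fun s : R => x + s *: d) (fun s => s *: d).
    apply: (is_diff_eq (is_diffD (is_diff_cst x t) (is_diff_scalel t d))).
    by apply/funext => s; rewrite fctE /= add0r.
  exact: (is_diff_comp dl (has_grad_diff (df t t01))).
have [||t t01] := @MVT R phi (fun t => dotv (grad f (x + t *: d)) d) 0 1 ltr01.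
- move=> t; rewrite in_itv/= => /andP[t0 t1].
  have [|dt dtE] := dphi t; first by rewrite !ltW.
  apply: DeriveDef; first exact/derivable1_diffP.
  by rewrite (@deriveE R R R phi t 1 dt) dtE scale1r.
- apply: continuous_in_subspaceT => t; rewrite inE/= in_itv/= => t01.
  by apply: differentiable_continuous; have [] := dphi t t01.
rewrite /phi scale1r scale0r addr0 subr0 mulr1 => ->.
by exists t => //; move: t01; rewrite in_itv.
Qed.

End Derivatives.

(** * Symmetric matrices and quadratic forms *)

Section QuadraticForms.
Context {R : realType}.

Definition qform n (A : 'M[R]_n) (u : 'rV[R]_n) : R := dotv (u *m A) u.

Lemma dotv_sym n (A : 'M[R]_n) u v :
  A^T = A -> dotv (u *m A) v = dotv u (v *m A).
Proof. by move=> sA; rewrite dotv_mulmx sA. Qed.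

Lemma qformB n (A B : 'M[R]_n) u : qform (A - B) u = qform A u - qform B u.
Proof. by rewrite /qform mulmxBr dotvBl. Qed.

Lemma qformZ n k (A : 'M[R]_n) u : qform (k *: A) u = k * qform A u.
Proof. by rewrite /qform -scalemxAr dotvZl. Qed.

Lemma qform_continuous n (A : 'M[R]_n) : continuous (qform A).
Proof.
(* polarization: the form is a difference of squared norms *)
have -> : qform A = fun y => 4^-1 * (dotv (y *m A + y) (y *m A + y)
    - dotv (y *m A - y) (y *m A - y)).
  apply/funext => y.
  by rewrite /qform !dotv_lin (dotvC y (y *m A)); field.
move=> x; have dA := has_jac_mulmx A x; have di := has_jac_id x.
have dp := has_grad_comp (has_jacD dA di) (has_grad_sqr _).
have dm := has_grad_comp (has_jacB dA di) (has_grad_sqr _).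
have [dq _] := has_gradZ 4^-1 (has_gradB dp dm).
exact: differentiable_continuous dq.
Qed.

(** Rayleigh: a minimizer of the quadratic form on the unit sphere is an
    eigenvector, because a form which is nonnegative everywhere and vanishes at
    a vector has a vanishing gradient there. *)
Lemma rayleigh n (A : 'M[R]_n) : A^T = A -> (exists u : 'rV[R]_n, u != 0) ->
  exists2 l, eigenvalue A l & forall u, l * dotv u u <= qform A u.
Proof.
move=> sA [u0 u00].
pose S := [set u : 'rV[R]_n | enorm u = 1].
have S0 : S !=set0.
  exists ((enorm u0)^-1 *: u0); rewrite /S/= enormZ.
  by rewrite gtr0_norm ?mulVf ?invr_gt0 ?gt_eqF ?enorm_gt0.
have cS : compact S.
  apply: bounded_closed_compact.
    exists 1; split=> // M M1 u /= u1; apply: le_trans (norm_le_enorm u) _.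
    by rewrite u1 ltW.
  have cn : continuous (fun u : 'rV[R]_n => enorm u).
    move=> x; have := @continuous_enorm_at R n 0 x.
    by rewrite (_ : (fun u => _) = fun u => enorm u)//; apply/funext => u;
      rewrite subr0.
  have := @closed_comp _ _ (fun u : 'rV[R]_n => enorm u) [set 1].
  by apply=> [u _|]; [exact: cn|exact: closed_eq].
have [c /[!inE] c1 cmin] := EVT_min_rV S0 cS
  (continuous_subspaceT (@qform_continuous _ A)).
have cc : dotv c c = 1 by rewrite -enorm_sqr c1 expr1n.
have lmin u : qform A c * dotv u u <= qform A u.
  have [->|u1] := eqVneq u 0; first by rewrite /qform dotv0 mul0mx dot0v mulr0.
  have eu : 0 < enorm u by rewrite enorm_gt0.
  have := cmin ((enorm u)^-1 *: u); rewrite inE /S/= => /(_ _)/wrap[].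
    by rewrite enormZ gtr0_norm ?invr_gt0// mulVf// gt_eqF.
  rewrite [in leRHS]/qform -scalemxAl dotvZl dotvZr mulrA -expr2.
  rewrite -enorm_sqr -ler_pdivlMr ?exprn_gt0// -/(qform A u) exprVn.
  by rewrite mulrC.
exists (qform A c) => //.
apply/eigenvalueP; exists c; last by rewrite -dotvv_eq0 cc oner_eq0.
set l := qform A c in lmin *.
have [w wE] : exists w, w = c *m A - l *: c by exists (c *m A - l *: c).
have cw : dotv c w = 0.
  by rewrite wE dotvBr dotvZr cc mulr1 dotvC -/(qform A c) subrr.
have quad t : 0 <= t * (2 * dotv w w) + t ^+ 2 * (qform A w - l * dotv w w).
  have := lmin (c + t *: w); rewrite /qform mulmxDl -scalemxAl !dotv_lin.
  rewrite -/(qform A c) -/(qform A w) -/l (dotv_sym w c sA).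
  have -> : dotv w (c *m A) = dotv w w.
    rewrite -[c *m A](subrK (l *: c)) -wE dotvDr dotvZr (dotvC w c) cw.
    by rewrite mulr0 addr0.
  have -> : dotv (c *m A) w = dotv w w.
    rewrite -[c *m A](subrK (l *: c)) -wE dotvDl dotvZl cw.
    by rewrite mulr0 addr0.
  by rewrite (dotvC w c) cw cc; nra.
suff : dotv w w == 0 by rewrite dotvv_eq0 wE subr_eq0 => /eqP.
apply: contrapT => /negP ww; have {}ww : 0 < dotv w w by rewrite lt0r ww dotvv_ge0.
pose q := `|qform A w - l * dotv w w| + 1.
have q0 : 0 < q by rewrite ltr_wpDl.
have := quad (- (dotv w w / q)).
have -> : - (dotv w w / q) * (2 * dotv w w) = - (2 * (dotv w w) ^+ 2 / q).
  by field; rewrite gt_eqF.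
have h : (dotv w w / q) ^+ 2 * (qform A w - l * dotv w w) <= dotv w w ^+ 2 / q.
  rewrite exprMn -mulrA ler_pM2l ?exprn_gt0// exprVn.
  rewrite mulrC ler_pdivrMr ?exprn_gt0// expr2 mulKf ?gt_eqF//.
  by rewrite (le_trans (ler_norm _))// lerDl.
have : 0 < dotv w w ^+ 2 / q by rewrite divr_gt0// exprn_gt0.
by rewrite sqrrN; lra.
Qed.

Lemma lambda_min_lt0 n (A : 'M[R]_n) : A^T = A ->
  (lambda_min A < 0) <-> exists u, qform A u < 0.
Proof.
move=> sA; split=> [lA|[u uA]].
  (* the infimum of the empty set is 0 *)
  have E0 : [set a | eigenvalue A a] !=set0.
    apply: contrapT => /nonemptyPn E0.
    by move: lA; rewrite /lambda_min E0 inf0 ltxx.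
  have [a /eigenvalueP[v vA v0] a0] := inf_lt E0 lA.
  by exists v; rewrite /qform vA dotvZl pmulr_llt0// dotvv_gt0.
have [|l lA lq] := rayleigh sA.
  exists u; apply: contraTneq uA => ->.
  by rewrite /qform dotv0 ltxx.
have l0 : l < 0.
  have := le_lt_trans (lq u) uA.
  by rewrite pmulr_llt0// dotvv_gt0; apply: contraTneq uA => ->;
    rewrite /qform dotv0 ltxx.
apply: le_lt_trans l0; apply: ge_inf => //.
exists l => a /= /eigenvalueP[v vA v0].
have := lq v; rewrite /qform vA dotvZl ler_pM2r//.
by rewrite dotvv_gt0.
Qed.

Lemma inj_mulmx_unit n (A : 'M[R]_n) :
  (forall u : 'rV[R]_n, u *m A = 0 -> u = 0) -> A \in unitmx.
Proof.
move=> Ainj; rewrite -row_free_unit -kermx_eq0; apply/eqP/row_matrixP => i.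
by rewrite row0; apply: Ainj; apply/sub_kermxP; exact: row_sub.
Qed.

Lemma qform_unit n (A : 'M[R]_n) :
  (forall u, u != 0 -> 0 < qform A u) -> A \in unitmx.
Proof.
move=> pA; apply: inj_mulmx_unit => u uA; apply/eqP.
by apply: contraPT uA => /pA; rewrite /qform => /[swap] ->; rewrite dot0v ltxx.
Qed.

(** Both forms are Schur complements of the form of the block matrix
    with rows (M, M) and (M, N), with respect to its two diagonal blocks. *)
Lemma schur_qform_lt0 n (M N : 'M[R]_n) :
  M^T = M -> N^T = N ->
  (forall u, u != 0 -> 0 < qform M u) -> (forall u, u != 0 -> 0 < qform N u) ->
  (exists u, qform (M - M *m invmx N *m M) u < 0) <->
  (exists v, qform (N - M) v < 0).
Proof.
move=> sM sN pM pN.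
have uN := qform_unit pN.
have ge0 (B : 'M[R]_n) v : (forall u, u != 0 -> 0 < qform B u) -> 0 <= qform B v.
  move=> pB; have [->|/pB/ltW//] := eqVneq v 0.
  by rewrite /qform dotv0.
(* the block form, with the square completed in either variable *)
have blockM u v : qform M (u + v) + qform (N - M) v =
    qform M u + 2 * dotv (u *m M) v + qform N v.
  rewrite qformB /qform mulmxDl !dotv_lin (dotv_sym v u sM) (dotvC v).
  by ring.
have blockN u v : qform N (v + u *m M *m invmx N) +
      qform (M - M *m invmx N *m M) u =
    qform M u + 2 * dotv (u *m M) v + qform N v.
  rewrite qformB /qform mulmxDl -[_ *m invmx N *m N]mulmxA mulVmx// mulmx1.
  rewrite !dotv_lin (dotv_sym v (u *m M *m invmx N) sN).
  rewrite -[_ *m invmx N *m N]mulmxA mulVmx// mulmx1 (dotvC v).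
  rewrite !mulmxA (dotv_sym (u *m M *m invmx N) u sM) (dotvC _ (u *m M)).
  by ring.
split=> [[u uneg]|[v vneg]].
  exists (- (u *m M *m invmx N)).
  have := blockM u (- (u *m M *m invmx N)); rewrite -blockN addNr.
  have := ge0 M (u - u *m M *m invmx N) pM.
  have -> : qform N 0 = 0 by rewrite /qform dotv0.
  by rewrite add0r; lra.
exists (- v); have := blockN (- v) v; rewrite -blockM addNr.
have := ge0 N (v + - v *m M *m invmx N) pN.
have -> : qform M 0 = 0 by rewrite /qform dotv0.
by rewrite add0r; lra.
Qed.

Lemma qform_congr_lt0 n (A K : 'M[R]_n) : K \in unitmx ->
  (exists u, qform (K *m A *m K^T) u < 0) <-> (exists u, qform A u < 0).
Proof.
move=> uK.
have KE u : qform (K *m A *m K^T) u = qform A (u *m K).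
  by rewrite /qform !mulmxA dotv_mulmx trmxK.
split=> -[u]; first by rewrite KE => ?; exists (u *m K).
by move=> uA; exists (u *m invmx K); rewrite KE mulmxKV.
Qed.

End QuadraticForms.

(** * Second derivatives *)

Section SecondDerivatives.
Context {R : realType}.

(** Taylor estimate for the mixed second difference: its left-hand side is
    symmetric in the two increments, and this forces the Hessian to be. *)
Lemma second_difference n (f : 'rV[R]_n -> R) x e :
  twice_differentiable_at f x -> 0 < e ->
  exists2 d, 0 < d & forall u v, enorm u + enorm v < d ->
    `|f (x + v + u) - f (x + v) - (f (x + u) - f x) - dotv (u *m hessian f x) v|
      <= e * (enorm u + enorm v) ^+ 2.
Proof.
move=> [df /has_jac_diff/has_jacP dg] e0.
have e20 : 0 < e / 2 by rewrite divr_gt0.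
have : \forall y \near x, differentiable f y /\ enorm (grad f y - grad f x
    - (y - x) *m jacobian (grad f) x) <= e / 2 * enorm (y - x).
  by apply: filterI df _; exact: dg.
move=> /near_enormP[d d0 hd].
exists d => // u v uv.
(* the mean value theorem for the increment of f along u, on the segment along v *)
pose F y := f (y + u) - f y.
have near_seg (t : R) : 0 <= t <= 1 -> enorm (x + t *: v - x) <= enorm v.
  move=> /andP[t0 t1]; rewrite addrAC subrr add0r enormZ ger0_norm//.
  by rewrite ler_piMl ?enorm_ge0.
have near_segu (t : R) : 0 <= t <= 1 ->
    enorm (x + t *: v + u - x) <= enorm u + enorm v.
  move=> /near_seg tv; rewrite addrAC; apply: le_trans (enormD _ _) _.
  by rewrite [leRHS]addrC lerD2r.
have dF (t : R) : 0 <= t <= 1 -> has_grad F (x + t *: v)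
    (grad f (x + t *: v + u) - grad f (x + t *: v)).
  move=> t01.
  have [|d1 _] := hd (x + t *: v + u).
    exact: le_lt_trans (near_segu t t01) uv.
  have [|d2 _] := hd (x + t *: v).
    by apply: le_lt_trans (near_seg t t01) _; have := enorm_ge0 u; lra.
  apply: has_gradB; last exact: has_grad_diff.
  have := has_grad_comp (has_jac_shift u (x + t *: v)) (has_grad_diff d1).
  by rewrite trmx1 mulmx1.
have [|t /andP[t0 t1]] := @mvt_segment _ _ F x v.
  by move=> t /dF [].
have t01 : 0 <= t <= 1 by rewrite !ltW.
rewrite (has_gradE (dF t t01)) /F => ->.
have [_ r1] := hd _ (le_lt_trans (near_segu t t01) uv).
have [|_ r2] := hd (x + t *: v).
  by apply: le_lt_trans (near_seg t t01) _; have := enorm_ge0 u; lra.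
rewrite -dotvBl; set H := hessian f x.
have -> : grad f (x + t *: v + u) - grad f (x + t *: v) - u *m H =
   (grad f (x + t *: v + u) - grad f x - (x + t *: v + u - x) *m H)
   - (grad f (x + t *: v) - grad f x - (x + t *: v - x) *m H).
  rewrite ![_ - x]addrAC subrr !add0r !mulmxDl.
  set a := grad _ _; set b := grad _ _; set c := grad _ _.
  by apply/rowP => i; rewrite !mxE; ring.
apply: le_trans (normr_dotv_le _ _) _.
set s := enorm u + enorm v.
apply: (@le_trans _ _ ((e / 2 * s + e / 2 * s) * enorm v)); last first.
  rewrite -mulrDl -splitr expr2 mulrA ler_wpM2l ?mulr_ge0 ?addr_ge0 ?enorm_ge0//.
    exact: ltW.
  by rewrite lerDr enorm_ge0.
rewrite ler_wpM2r ?enorm_ge0//; apply: le_trans (enormB _ _) _; apply: lerD.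
  by apply: le_trans r1 _; rewrite ler_pM2l// near_segu.
apply: le_trans r2 _; rewrite ler_pM2l//; apply: le_trans (near_seg t t01) _.
by rewrite lerDr enorm_ge0.
Qed.

Lemma hessian_sym n (f : 'rV[R]_n -> R) x :
  twice_differentiable_at f x -> (hessian f x)^T = hessian f x.
Proof.
move=> d2f; apply: mulmx_rV_inj => u; apply: dotv_inj; apply/funext => v.
rewrite dotv_mulmx trmxK dotvC; set H := hessian f x.
apply: contrapT => /eqP; rewrite -subr_eq0 -normr_gt0.
set g := `|_| => g0.
pose k := enorm u + enorm v.
have k0 : 0 <= k by rewrite addr_ge0 ?enorm_ge0.
have e0 : 0 < g / (4 * (k + 1) ^+ 2).
  by rewrite divr_gt0// mulr_gt0// exprn_gt0// ltr_wpDl.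
have [d d0 hd] := second_difference d2f e0.
pose t := d / (2 * (k + 1)).
have t0 : 0 < t by rewrite divr_gt0// mulr_gt0// ltr_wpDl.
have tk : enorm (t *: u) + enorm (t *: v) = t * k.
  by rewrite !enormZ gtr0_norm// -mulrDr.
have tkd : t * k < d.
  rewrite /t mulrAC ltr_pdivrMr ?mulr_gt0 ?ltr_wpDl// ltr_pM2l//; lra.
have := hd (t *: u) (t *: v); rewrite tk => /(_ tkd).
have := hd (t *: v) (t *: u); rewrite addrC tk => /(_ tkd).
rewrite -!scalemxAl !dotvZl !dotvZr [x + t *: u + t *: v]addrAC -/H.
set D := f _.
set a := f _; set b := f _; set c := f x.
set p := dotv _ _; set q := dotv _ _ => h1 h2.
have : `|t ^+ 2 * (p - q)| <= 2 * (g / (4 * (k + 1) ^+ 2) * (t * k) ^+ 2).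
  have -> : t ^+ 2 * (p - q) =
    (D - b - (a - c) - t * (t * q)) - (D - a - (b - c) - t * (t * p)) by ring.
  by apply: le_trans (ler_normB _ _) _; rewrite mulr_natl mulr2n lerD.
rewrite normrM ger0_norm ?sqr_ge0// (exprMn _ t k).
have -> : `|p - q| = g by rewrite /g distrC.
have -> : 2 * (g / (4 * (k + 1) ^+ 2) * (t ^+ 2 * k ^+ 2)) =
    t ^+ 2 * (g * (k ^+ 2 / (2 * (k + 1) ^+ 2))).
  by field; rewrite gt_eqF// ltr_wpDl.
rewrite ler_pM2l ?exprn_gt0// -ler_pdivrMl// mulVf ?gt_eqF//.
by rewrite ler_pdivlMr ?mulr_gt0 ?exprn_gt0 ?ltr_wpDl// mul1r; nra.
Qed.

Lemma has_jac_lipschitz_le n m (F : 'rV[R]_n -> 'rV[R]_m) x A c :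
  has_jac F x A -> (forall y, enorm (F y - F x) <= c * enorm (y - x)) ->
  forall v, enorm (v *m A) <= c * enorm v.
Proof.
move=> /has_jacP FA Fc v; apply: contrapT => /negP; rewrite -ltNge => cv.
have v0 : 0 < enorm v.
  rewrite enorm_gt0; apply: contraTneq cv => ->.
  by rewrite mul0mx !enorm0 mulr0 ltxx.
pose e := (enorm (v *m A) - c * enorm v) / (2 * enorm v).
have e0 : 0 < e by rewrite divr_gt0 ?mulr_gt0// subr_gt0.
have /near_enormP[d d0 hd] := FA _ e0.
pose t := d / (2 * enorm v).
have t0 : 0 < t by rewrite divr_gt0// mulr_gt0.
have tv : t * enorm v < d.
  have -> : t * enorm v = d / 2 by rewrite /t; field; rewrite gt_eqF.
  lra.
have := hd (x + t *: v); have := Fc (x + t *: v).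
rewrite [x + _ - x]addrAC subrr add0r enormZ gtr0_norm// => h1 /(_ tv) h2.
have := enormB (F (x + t *: v) - F x) (F (x + t *: v) - F x - (t *: v) *m A).
rewrite opprB addrC subrK -scalemxAl enormZ gtr0_norm// scalemxAl => h3.
have : t * enorm (v *m A) <= t * (c * enorm v + e * enorm v).
  by rewrite mulrDr [t * (c * _)]mulrCA [t * (e * _)]mulrCA; lra.
rewrite ler_pM2l//.
have -> : e * enorm v = (enorm (v *m A) - c * enorm v) / 2.
  by rewrite /e; field; rewrite gt_eqF.
lra.
Qed.

(** The gradient of f y - <grad f x, y> + M/2 |y - x|^2 has a nonnegative inner
    product with y - x, so this function is at least its value at x. *)
Lemma descent n (f : 'rV[R]_n -> R) M : lipschitz_differentiable M f ->
  forall x y, f x + dotv (grad f x) (y - x) - M / 2 * dotv (y - x) (y - x) <= f y.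
Proof.
move=> [M0 df lf] x y; have [d dE] : exists d, d = y - x by exists (y - x).
pose F z := f z - dotv (grad f x) z + M / 2 * dotv (z - x) (z - x).
have dF z : has_grad F z (grad f z - grad f x + (M / 2) *: (2 *: (z - x))).
  apply: has_gradD; last exact/has_gradZ/has_grad_sqr_dist.
  by apply: has_gradB; [exact: has_grad_diff|exact: has_grad_dotv].
have [|t /andP[t0 t1]] := @mvt_segment _ _ F x d.
  by move=> t _; have [] := dF (x + t *: d).
have xtd s : x + s *: d - x = s *: d by rewrite addrAC subrr add0r.
have -> : x + d = y by rewrite dE addrC subrK.
rewrite (has_gradE (dF _)) /F xtd -dE.
have := lf (x + t *: d) x; rewrite xtd enormZ gtr0_norm// => ld.
have := normr_dotv_le (grad f (x + t *: d) - grad f x) d.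
have : enorm (grad f (x + t *: d) - grad f x) * enorm d <= M * t * dotv d d.
  by rewrite -enorm_sqr expr2 mulrA ler_wpM2r ?enorm_ge0// -mulrA.
rewrite ler_norml subrr dot0v => h1 /andP[h2 _].
have -> : dotv (grad f x) d = dotv (grad f x) y - dotv (grad f x) x.
  by rewrite dE dotvBr.
move: h1 h2; rewrite !dotv_lin.
move: (dotv (grad f (x + _)) d) (dotv (grad f x) d) (enorm _ * enorm d).
move: (dotv (grad f x) x) (dotv (grad f x) y) => a b p q r.
by nra.
Qed.

(** The differential half of the inverse function theorem: a Lipschitz right
    inverse P is given, so that the remainder of T, which is small with respect to
    P y - P w, is small with respect to y - w. *)
Lemma has_jac_inverse n (T P : 'rV[R]_n -> 'rV[R]_n) w A c :
  has_jac T (P w) A -> A \in unitmx ->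
  (forall y, enorm (P y - P w) <= c * enorm (y - w)) ->
  (\forall y \near w, T (P y) = y) -> has_jac P w (invmx A).
Proof.
move=> /has_jacP TA uA Pc TP; apply/has_jacP => e e0.
have Tw : T (P w) = w by exact: nbhs_singleton TP.
have [C C0 hC] := enorm_mulmx_bounded (invmx A).
pose c' := `|c| + 1; have c0 : 0 < c' by rewrite ltr_wpDl.
have {}Pc y : enorm (P y - P w) <= c' * enorm (y - w).
  apply: le_trans (Pc y) _; rewrite ler_wpM2r ?enorm_ge0//.
  by rewrite (le_trans (ler_norm _))// lerDl.
have e'0 : 0 < e / (C * c') by rewrite divr_gt0// mulr_gt0.
have cP := lipschitz_continuous_at Pc.
near=> y.
have Ty : T (P y) = y by near: y.
have : enorm (T (P y) - T (P w) - (P y - P w) *m A) <=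
    e / (C * c') * enorm (P y - P w).
  by near: y; exact: cP _ (TA _ e'0).
rewrite Ty Tw => h.
have -> : P y - P w - (y - w) *m invmx A =
    - ((y - w - (P y - P w) *m A) *m invmx A).
  by rewrite [in RHS]mulmxBl mulmxK// opprB.
rewrite enormN; apply: le_trans (hC _) _.
apply: (@le_trans _ _ (C * (e / (C * c') * (c' * enorm (y - w))))).
  by rewrite ler_pM2l//; apply: le_trans h _; rewrite ler_pM2l.
rewrite le_eqVlt; apply/orP; left; apply/eqP.
by field; rewrite !gt_eqF.
Unshelve. all: by end_near. Qed.

(** Product rule for a first factor that vanishes at the point: the second factor
    is then multiplied by a quantity of order y - x, so that its continuity is
    enough. *)
Lemma has_jac_mulmx0 n m p (F : 'rV[R]_n -> 'rV[R]_m)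
    (C : 'rV[R]_n -> 'M[R]_(m, p)) x A :
  F x = 0 -> has_jac F x A -> {for x, continuous C} ->
  has_jac (fun y => F y *m C y) x (A *m C x).
Proof.
move=> Fx0 /has_jacP FA cC; apply/has_jacP => e e0.
have [K K0 hK] := enorm_mulmx_bounded A.
have [K' K'0 hK'] := enorm_mulmx_bounded (C x).
have e1 : 0 < e / (2 * K') by rewrite divr_gt0// mulr_gt0.
pose s : R := (p * m)%:R + 1.
have s0 : 0 < s by rewrite ltr_wpDl.
have e2 : 0 < e / (2 * s * (K + 1)) by rewrite divr_gt0// ?mulr_gt0// ltr_wpDl// ltW.
near=> y; rewrite Fx0 mul0mx subr0.
have : enorm (F y - F x - (y - x) *m A) <= e / (2 * K') * enorm (y - x).
  by near: y; exact: FA.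
have : enorm (F y - F x - (y - x) *m A) <= 1 * enorm (y - x).
  by near: y; exact: FA.
rewrite Fx0 subr0 => h1 h2.
have h3 : enorm (F y) <= (K + 1) * enorm (y - x).
  rewrite -[F y](subrK ((y - x) *m A)); apply: le_trans (enormD _ _) _.
  by have := hK (y - x); lra.
have Cy : `|C y - C x| <= e / (2 * s * (K + 1)).
  rewrite distrC; near: y; apply: cvgr_dist_le => //; exact: cC.
have -> : F y *m C y - (y - x) *m (A *m C x) =
    F y *m (C y - C x) + (F y - (y - x) *m A) *m C x.
  by rewrite mulmxBr [(F y - _) *m C x]mulmxBl addrA subrK mulmxA.
apply: le_trans (enormD _ _) _; rewrite [in leRHS](splitr e) mulrDl; apply: lerD.
  apply: le_trans (enorm_mulmx_norm _ _) _.
  apply: (@le_trans _ _ (s * (e / (2 * s * (K + 1))) * ((K + 1) * enorm (y - x)))).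
    by rewrite ler_pM ?mulr_ge0 ?enorm_ge0// ler_pM// lerDl.
  rewrite le_eqVlt; apply/orP; left; apply/eqP.
  by field; rewrite !gt_eqF// ltr_wpDl// ltW.
apply: le_trans (hK' _) _.
apply: (@le_trans _ _ (K' * (e / (2 * K') * enorm (y - x)))).
  by rewrite ler_pM2l.
rewrite le_eqVlt; apply/orP; left; apply/eqP.
by field; rewrite gt_eqF.
Unshelve. all: by end_near. Qed.

(** The same rule for the product S = W J^-1.  With K = J x, the identity
    S y = (W y - S y (J y - K)) K^-1 first bounds S y by a multiple of y - x, and
    then shows that S and W K^-1 agree to first order. *)
Lemma has_jac_divmx0 n m (S W : 'rV[R]_n -> 'rV[R]_m)
    (J : 'rV[R]_n -> 'M[R]_m) x A :
  (forall y, S y *m J y = W y) -> J x \in unitmx -> W x = 0 ->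
  has_jac W x A -> {for x, continuous J} ->
  has_jac S x (A *m invmx (J x)).
Proof.
move=> SJ uJ Wx0 /has_jacP WA cJ; apply/has_jacP => e e0.
have Sx0 : S x = 0 by rewrite -[S x](mulmxK uJ) SJ Wx0 mul0mx.
have [K K0 hK] := enorm_mulmx_bounded A.
have [C C0 hC] := enorm_mulmx_bounded (invmx (J x)).
pose s : R := (m * m)%:R + 1.
have s0 : 0 < s by rewrite ltr_wpDl.
have e1 : 0 < e / (2 * C) by rewrite divr_gt0// mulr_gt0.
pose c := 2 * C * (K + 1); have c0 : 0 < c by rewrite !mulr_gt0// ltr_wpDl// ltW.
have cs0 : 0 < 2 * C * s by rewrite !mulr_gt0.
have e2 : 0 < e / (2 * C * s * c) by rewrite divr_gt0// mulr_gt0.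
have e3 : 0 < (2 * C * s)^-1 by rewrite invr_gt0.
near=> y; rewrite Sx0 subr0.
have : enorm (W y - W x - (y - x) *m A) <= e / (2 * C) * enorm (y - x).
  by near: y; exact: WA.
have : enorm (W y - W x - (y - x) *m A) <= 1 * enorm (y - x).
  by near: y; exact: WA.
rewrite Wx0 subr0 => h1 h2.
have h3 : enorm (W y) <= (K + 1) * enorm (y - x).
  rewrite -[W y](subrK ((y - x) *m A)); apply: le_trans (enormD _ _) _.
  by have := hK (y - x); lra.
have J2 : `|J y - J x| <= e / (2 * C * s * c).
  rewrite distrC; near: y; apply: cvgr_dist_le => //; exact: cJ.
have J3 : `|J y - J x| <= (2 * C * s)^-1.
  rewrite distrC; near: y; apply: cvgr_dist_le => //; exact: cJ.
have SE : S y = W y *m invmx (J x) - S y *m (J y - J x) *m invmx (J x).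
  by rewrite -mulmxBl mulmxBr SJ opprB addrC subrK mulmxK.
have SJJ d : `|J y - J x| <= d ->
    enorm (S y *m (J y - J x) *m invmx (J x)) <= C * (s * d * enorm (S y)).
  move=> Jd; apply: le_trans (hC _) _; rewrite ler_pM2l//.
  apply: le_trans (enorm_mulmx_norm _ _) _.
  by rewrite ler_pM ?mulr_ge0 ?enorm_ge0// ler_pM// lerDl.
have h4 : enorm (S y) <= c * enorm (y - x).
  have : enorm (S y) <= C * enorm (W y) + enorm (S y) / 2.
    rewrite {1}SE; apply: le_trans (enormB _ _) _; apply: lerD; first exact: hC.
    apply: le_trans (SJJ _ J3) _; rewrite le_eqVlt; apply/orP; left; apply/eqP.
    by field; rewrite !gt_eqF.
  have : C * enorm (W y) <= C * ((K + 1) * enorm (y - x)) by rewrite ler_pM2l.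
  by rewrite /c; lra.
have -> : S y - (y - x) *m (A *m invmx (J x)) =
    (W y - (y - x) *m A) *m invmx (J x) - S y *m (J y - J x) *m invmx (J x).
  by rewrite mulmxA [(W y - _) *m _]mulmxBl addrAC -SE.
apply: le_trans (enormB _ _) _; rewrite [in leRHS](splitr e) mulrDl; apply: lerD.
  apply: le_trans (hC _) _.
  apply: (@le_trans _ _ (C * (e / (2 * C) * enorm (y - x)))).
    by rewrite ler_pM2l.
  rewrite le_eqVlt; apply/orP; left; apply/eqP.
  by field; rewrite gt_eqF.
apply: le_trans (SJJ _ J2) _.
apply: (@le_trans _ _ (C * (s * (e / (2 * C * s * c)) * (c * enorm (y - x))))).
  by rewrite ler_pM2l// ler_pM2l// (mulr_gt0 s0 e2).
rewrite le_eqVlt; apply/orP; left; apply/eqP.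
by field; rewrite !gt_eqF.
Unshelve. all: by end_near. Qed.

End SecondDerivatives.

(** * Proximal mappings of weakly convex functions *)

Section LowerSemicontinuous.
Context {R : realType}.
Local Open Scope ereal_scope.

(** If every value on K exceeded the infimum r, then lower semicontinuity and
    compactness would give a single i > r below all of them. *)
Lemma lsc_attains_min (T : topologicalType) (F : T -> \bar R) (K : set T) (c : R) :
  lower_semicontinuous F -> compact K -> K !=set0 -> (forall t, c%:E <= F t) ->
  exists2 u, K u & forall t, K t -> F u <= F t.
Proof.
move=> lF cK [k Kk] cF; apply: contrapT => noMin.
have infF t : K t -> ereal_inf (F @` K) <= F t.
  by move=> Kt; apply: ereal_inf_lbound; exists t.
have cinf : c%:E <= ereal_inf (F @` K).
  by apply: le_ereal_inf_tmp => _ [t _ <-].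
have [r rE] : exists r : R, ereal_inf (F @` K) = r%:E.
  move: cinf infF; case: (ereal_inf _) => [r||] //; first by exists r.
  move=> _ infF; exfalso; apply: noMin; exists k => // t Kt.
  by apply: le_trans (leey _) (infF t Kt).
rewrite rE in infF.
have ltF t : K t -> r%:E < F t.
  move=> Kt; rewrite ltNge; apply/negP => Ftr; apply: noMin.
  by exists t => // s /infF; exact: le_trans.
have KF : \forall i \near r^'+, K `<=` (fun t => i%:E < F t).
  apply: ((compact_near_coveringP K).1 cK R r^'+ (fun i t => i%:E < F t)) => x Kx.
  have [a ra aFx] : exists2 a : R, (r < a)%R & a%:E < F x.
    have := ltF x Kx; case: (F x) => [s||] //; rewrite ?lte_fin => rs.
      by exists ((r + s) / 2)%R; rewrite ?lte_fin; lra.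
    by exists (r + 1)%R; rewrite ?ltry// ltrDl.
  have [V Vx VF] := lF x a aFx.
  exists (V, [set i | (i < a)%R]) => /=.
    by split=> //; exact: nbhs_right_lt.
  move=> [y i] /= [Vy ia]; apply: lt_trans (VF y Vy).
  by rewrite lte_fin.
have [i [ri Ki]] : exists i, (r < i)%R /\ K `<=` [set t | i%:E < F t].
  apply: (@filter_ex _ r^'+); apply: filterI => //.
  exact: nbhs_right_gt.
have : i%:E <= ereal_inf (F @` K).
  by apply: le_ereal_inf_tmp => _ [t Kt <-]; apply/ltW/Ki.
by rewrite rE lee_fin leNgt ri.
Qed.

Lemma lscD_continuous (T : topologicalType) (F : T -> \bar R) (q : T -> R) :
  lower_semicontinuous F -> (forall t, -oo < F t) -> continuous q ->
  lower_semicontinuous (fun t => F t + (q t)%:E).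
Proof.
move=> lF F0 cq x a aFx.
have [b abx bFx] : exists2 b : R, (a - q x < b)%R & b%:E < F x.
  have := F0 x; case: (F x) aFx => [s||] //.
    rewrite -EFinD lte_fin => as_ _; exists ((a - q x + s) / 2)%R; first lra.
    by rewrite lte_fin; lra.
  by move=> _ _; exists (a - q x + 1)%R; [lra|exact: ltry].
have [V Vx VF] := lF x b bFx.
have qx : \forall y \near x, (a - b < q y)%R.
  have h : (a - b < q x)%R by lra.
  exact: (cq x _ (lt_nbhsr h)).
exists (V `&` [set y | (a - b < q y)%R]); first exact: filterI.
move=> y [/VF + /= aby]; have := F0 y; case: (F y) => [s||] //.
  by rewrite -EFinD !lte_fin => _ bs; lra.
by move=> _ _; exact: ltry.
Qed.

End LowerSemicontinuous.

(** The last condition, a quadratic growth bound with a constant strictly smaller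
    than that of the proximal penalty, makes the penalized function coercive. *)
Definition proximable (R : realType) n (gamma beta : R) (xi : 'rV[R]_n -> \bar R) :=
  [/\ proper xi, lower_semicontinuous xi, weakly_convex beta xi,
      beta / 2 < (2 * gamma)^-1
    & exists2 a, a < (2 * gamma)^-1 &
      bounded_below (fun x => xi x + (a * enorm x ^+ 2)%:E)%E].

Section ProxAlgebra.
Context {R : realType} {n : nat}.
Implicit Types u v y z : 'rV[R]_n.

Lemma sqr_dist_exchange u v y z :
  enorm (u - z) ^+ 2 - enorm (v - z) ^+ 2 +
    (enorm (v - y) ^+ 2 - enorm (u - y) ^+ 2) = 2 * dotv (u - v) (y - z).
Proof.
rewrite !enorm_sqr !dotv_lin (dotvC z u) (dotvC z v) (dotvC y u) (dotvC y v).
by ring.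
Qed.

Lemma sqr_dist_shift v y z :
  enorm (v - y) ^+ 2 =
    enorm (v - z) ^+ 2 + enorm (y - z) ^+ 2 + 2 * dotv (z - v) (y - z).
Proof.
by rewrite !enorm_sqr !dotv_lin (dotvC y v) (dotvC z v) (dotvC z y); ring.
Qed.

(** The sum of the growth inequalities of two proximal points, each tested at the
    other one; K is the growth constant and l the penalty. *)
Lemma contraction_arith (K l q d A B C D s r : R) :
  r + l * B + K * q <= s + l * A -> s + l * D + K * q <= r + l * C ->
  A - B + (C - D) = 2 * d -> K * q <= l * d.
Proof.
move=> i1 i2 ex.
have : l * (A - B + (C - D)) = l * (2 * d) by rewrite ex.
lra.
Qed.

(** The two bounds on the increment of a Moreau envelope, from r + l B to s + l C;
    m is a Lipschitz constant of the proximal mapping. *)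
Lemma envelope_arith (l c d q m A B C D s r : R) : 0 < l -> 0 <= q ->
  s + l * C <= r + l * D -> r + l * B <= s + l * A ->
  A - B + (D - C) = 2 * c -> D = B + q + 2 * d -> `|c| <= m * q ->
  `|s + l * C - (r + l * B) - 2 * l * d| <= l * (1 + 2 * m) * q.
Proof.
move=> l0 q0 i1 i2 ex DE; rewrite !ler_norml.
move=> /andP[/(ler_wpM2l (ltW l0)) c1 /(ler_wpM2l (ltW l0)) c2].
have : l * (A - B + (D - C)) = l * (2 * c) by rewrite ex.
have := mulr_ge0 (ltW l0) q0; rewrite DE in i1 *.
by move=> *; apply/andP; split; lra.
Qed.

Lemma complete_square (d X E : R) : d != 0 ->
  d * (X - E / (2 * d)) ^+ 2 = d * X ^+ 2 - E * X + E ^+ 2 / (4 * d).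
Proof. by move=> d0; field. Qed.

End ProxAlgebra.

Section Prox.
Context {R : realType} {n : nat}.
Variables (gamma beta : R) (xi : 'rV[R]_n -> \bar R).
Hypotheses (gamma_gt0 : 0 < gamma) (xi_prox : proximable gamma beta xi).

Let k := (2 * gamma)^-1.

Let k_gt0 : 0 < k. Proof. by rewrite invr_gt0 mulr_gt0. Qed.

(** Outside a large enough box K the penalized function exceeds its value at a
    point x0 where it is finite, and on the compact K it attains its minimum. *)
Lemma argmin_prox_exists z : argmin (prox_objective gamma xi z) !=set0.
Proof.
have [[xi_gt [x0 x0fin]] xi_lsc _ _ [a ak [c hc]]] := xi_prox.
have [r0 r0E] : exists r0 : R, xi x0 = r0%:E.
  by move: x0fin (xi_gt x0); case: (xi x0) => // r _ _; exists r.
rewrite -/k in ak.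
pose r := r0 + k * enorm (x0 - z) ^+ 2.
have objx0 : prox_objective gamma xi z x0 = r%:E.
  by rewrite /prox_objective r0E.
pose b := 2 * k * enorm z.
have b0 : 0 <= b by rewrite !mulr_ge0 ?enorm_ge0// ltW.
pose rho := 1 + enorm x0 + (b + `|r - c|) / (k - a).
have ka0 : 0 < k - a by rewrite subr_gt0.
have q0 : 0 <= (b + `|r - c|) / (k - a).
  by apply: divr_ge0; [exact: addr_ge0|exact: ltW].
pose K := [set u : 'rV[R]_n | forall i, `[- rho, rho]%classic (u ord0 i)].
have cK : compact K.
  by apply: (@rV_compact R n (fun=> `[- rho, rho]%classic)) => i;
    exact: segment_compact.
have Kx0 : K x0.
  move=> i /=; rewrite in_itv/= -ler_norml; apply: le_trans (coord_le_enorm _ _) _.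
  by rewrite /rho; lra.
have growth u : ((c - a * enorm u ^+ 2 + k * enorm (u - z) ^+ 2)%:E <=
    prox_objective gamma xi z u)%E.
  rewrite /prox_objective -/k; have := hc u; have := xi_gt u.
  case: (xi u) => [s||] // _; last by move=> _; rewrite addye// leey.
  by rewrite -!EFinD !lee_fin; lra.
have outK u : ~ K u -> (r%:E < prox_objective gamma xi z u)%E.
  move=> Ku; have Tu : rho < enorm u.
    rewrite ltNge; apply/negP => ur; apply: Ku => i /=.
    by rewrite in_itv/= -ler_norml (le_trans (coord_le_enorm _ _)).
  apply: lt_le_trans (growth u); rewrite lte_fin.
  have -> : enorm (u - z) ^+ 2 = enorm u ^+ 2 - 2 * dotv u z + enorm z ^+ 2.
    by rewrite !enorm_sqr !dotv_lin (dotvC z u); ring.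
  have h1 : k * (2 * dotv u z) <= b * enorm u.
    rewrite /b; have := dotv_le_enorm u z; rewrite -(ler_pM2l k_gt0); lra.
  have h2 : b + `|r - c| < (k - a) * enorm u.
    rewrite -ltr_pdivrMl// mulrC; apply: le_lt_trans Tu.
    by rewrite /rho; have := enorm_ge0 x0; lra.
  have h3 : 1 <= enorm u.
    by apply: le_trans (ltW Tu); rewrite /rho; have := enorm_ge0 x0; lra.
  have h4 : (b + `|r - c|) * enorm u < (k - a) * enorm u * enorm u.
    by rewrite ltr_pM2r//; lra.
  have h5 : `|r - c| <= `|r - c| * enorm u by rewrite ler_peMr.
  have h6 : 0 <= k * enorm z ^+ 2 by rewrite mulr_ge0 ?sqr_ge0// ltW.
  have := ler_norm (r - c).
  by move: h1 h4 h5 h6; rewrite expr2; lra.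
have lower u : ((c - b ^+ 2 / (4 * (k - a)))%:E <= prox_objective gamma xi z u)%E.
  apply: le_trans (growth u); rewrite lee_fin.
  have -> : enorm (u - z) ^+ 2 = enorm u ^+ 2 - 2 * dotv u z + enorm z ^+ 2.
    by rewrite !enorm_sqr !dotv_lin (dotvC z u); ring.
  have h1 : k * (2 * dotv u z) <= b * enorm u.
    rewrite /b; have := dotv_le_enorm u z; rewrite -(ler_pM2l k_gt0); lra.
  have h6 : 0 <= k * enorm z ^+ 2 by rewrite mulr_ge0 ?sqr_ge0// ltW.
  have : 0 <= (k - a) * (enorm u - b / (2 * (k - a))) ^+ 2.
    by rewrite mulr_ge0 ?sqr_ge0// ltW.
  by rewrite complete_square ?gt_eqF//; lra.
have obj_lsc : lower_semicontinuous (prox_objective gamma xi z).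
  apply: lscD_continuous => // u.
  have [dq _] := has_gradZ k (has_grad_sqr_dist z u).
  rewrite (_ : (fun v => _) = (fun y => k * dotv (y - z) (y - z))).
    exact: differentiable_continuous dq.
  by apply/funext => v; rewrite enorm_sqr.
have [u Ku umin] := lsc_attains_min obj_lsc cK (ex_intro _ x0 Kx0) lower.
exists u => v; have [/umin//|/outK/ltW] := pselect (K v).
by apply: le_trans; rewrite -objx0; exact: umin.
Qed.

Local Notation p := (prox gamma xi).
Local Notation obj := (prox_objective gamma xi).

Lemma prox_argmin z : argmin (obj z) (p z).
Proof. by have [u uz] := argmin_prox_exists z; exact: xgetPex (ex_intro _ u uz). Qed.

(* from here on, prox is known only through [prox_argmin] *)
Local Opaque prox.

Lemma prox_fin z : xi (p z) \is a fin_num.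
Proof.
have [[xi_gt [x0 x0fin]] _ _ _ _] := xi_prox.
have := prox_argmin z x0; rewrite /prox_objective.
have := xi_gt (p z); have := xi_gt x0.
by case: (xi (p z)) => // _; case: (xi x0) x0fin.
Qed.

Let kappa := k - beta / 2.

Let kappa_gt0 : 0 < kappa.
Proof. by have [_ _ _ ? _] := xi_prox; rewrite subr_gt0. Qed.

(** The penalized function is strongly convex, hence grows quadratically away
    from its minimizer. *)
Lemma prox_growth z v :
  (obj z (p z) + (kappa * enorm (v - p z) ^+ 2)%:E <= obj z v)%E.
Proof.
have [[xi_gt _] _ wc _ _] := xi_prox.
have pmin := prox_argmin z; move: (prox_fin z); move: (p z) pmin => u umin.
rewrite /prox_objective -/k.
case uE : (xi u) => [s||] // _.
have := xi_gt v; case vE : (xi v) => [r||] // _; last by rewrite addye// leey.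
rewrite -!EFinD lee_fin.
set D := r + k * enorm (v - z) ^+ 2 - (s + k * enorm (u - z) ^+ 2).
set q := enorm (v - u) ^+ 2.
suff : kappa * q <= D by rewrite /D; lra.
(* the minimizer u is compared with the points of the segment from u to v *)
have chord (t : R) : 0 < t < 1 -> kappa * (1 - t) * q <= D.
  move=> /andP[t0 t1].
  have := wc v u t; rewrite uE vE (ltW t0) (ltW t1) => /(_ isT).
  have := umin (t *: v + (1 - t) *: u); rewrite /prox_objective uE -/k.
  have := xi_gt (t *: v + (1 - t) *: u).
  case: (xi _) => [w||] // _; rewrite -!EFinM -!EFinD !lee_fin => h1 h2.
  rewrite -(ler_pM2l t0).
  have sq : enorm (t *: v + (1 - t) *: u) ^+ 2 =
      t * enorm v ^+ 2 + (1 - t) * enorm u ^+ 2 - t * (1 - t) * q.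
    by rewrite /q !enorm_sqr !dotv_lin (dotvC u v); ring.
  have sqz : enorm (t *: v + (1 - t) *: u - z) ^+ 2 =
      t * enorm (v - z) ^+ 2 + (1 - t) * enorm (u - z) ^+ 2 - t * (1 - t) * q.
    rewrite /q !enorm_sqr !dotv_lin (dotvC u v) (dotvC z v) (dotvC z u).
    by ring.
  move: h1 h2; rewrite sq sqz /D /kappa.
  move: (enorm _ ^+ 2) (enorm _ ^+ 2) (enorm _ ^+ 2) (enorm _ ^+ 2) => A B C E.
  by move: (q) => Q; lra.
apply: contrapT => /negP; rewrite -ltNge => Dq.
have D0 : 0 <= D.
  have := umin v; rewrite /prox_objective uE vE -!EFinD lee_fin /D -/k; lra.
have kq : 0 < kappa * q by lra.
(* the term in 1 - t is lost as t tends to 0; this t already contradicts Dq *)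
have t01 : 0 < (kappa * q - D) / (2 * (kappa * q)) < 1.
  apply/andP; split; first by rewrite divr_gt0 ?subr_gt0// mulr_gt0.
  by rewrite ltr_pdivrMr; [lra|rewrite mulr_gt0].
have := chord _ t01.
have -> : kappa * (1 - (kappa * q - D) / (2 * (kappa * q))) * q
    = (kappa * q + D) / 2.
  by field; rewrite !gt_eqF//; move: kq; rewrite pmulr_rgt0.
lra.
Qed.

Lemma obj_fin z u : xi u \is a fin_num ->
  obj z u = (fine (xi u) + k * enorm (u - z) ^+ 2)%:E.
Proof. by move=> ufin; rewrite /prox_objective EFinD fineK. Qed.

Lemma prox_growth_fin z v : xi v \is a fin_num ->
  fine (xi (p z)) + k * enorm (p z - z) ^+ 2 + kappa * enorm (v - p z) ^+ 2 <=
  fine (xi v) + k * enorm (v - z) ^+ 2.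
Proof.
move=> vfin; have := prox_growth z v.
by rewrite !obj_fin ?prox_fin// -EFinD lee_fin.
Qed.

(** Adding the growth inequalities of the two proximal points leaves an inner
    product, bounded by Cauchy-Schwarz. *)
Lemma prox_lipschitz y z : enorm (p y - p z) <= k / kappa * enorm (y - z).
Proof.
have h1 := prox_growth_fin z (prox_fin y).
have h2 := prox_growth_fin y (prox_fin z).
rewrite [enorm (p z - p y)]enorm_distC in h2.
have h := contraction_arith h1 h2 (sqr_dist_exchange (p y) (p z) y z).
have [->|yz] := eqVneq (p y) (p z).
  by rewrite subrr enorm0 mulr_ge0 ?enorm_ge0// ltW// divr_gt0.
have e0 : 0 < enorm (p y - p z) by rewrite enorm_gt0 subr_eq0.
rewrite mulrAC ler_pdivlMr// mulrC -(ler_pM2r e0).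
rewrite -mulrA -expr2; apply: le_trans h _.
by rewrite -mulrA ler_pM2l// mulrC dotv_le_enorm.
Qed.

Lemma moreauE z :
  moreau gamma xi z = (fine (xi (p z)) + k * enorm (p z - z) ^+ 2)%:E.
Proof.
rewrite -obj_fin ?prox_fin//.
apply/eqP; rewrite eq_le; apply/andP; split.
  by apply: ereal_inf_lbound; exists (p z).
by apply: le_ereal_inf_tmp => _ [u _ <-]; exact: prox_argmin.
Qed.

Lemma moreau_le y z :
  fine (moreau gamma xi y) <= fine (xi (p z)) + k * enorm (p z - y) ^+ 2.
Proof.
have := prox_argmin y (p z).
rewrite (obj_fin y (prox_fin y)) (obj_fin y (prox_fin z)) lee_fin => h.
by rewrite moreauE; exact: h.
Qed.

(** The envelope lies below the penalized function of each fixed competitor; the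
    competitors prox z and prox y bound the increment between z and y on both
    sides, up to a quadratic error because prox is Lipschitz. *)
Lemma has_grad_moreau z :
  has_grad (fine \o moreau gamma xi) z (gamma^-1 *: (z - p z)).
Proof.
apply/has_gradP => e e0.
pose K := k * (1 + 2 * (k / kappa)).
have kk : 0 < k / kappa by rewrite divr_gt0.
have K0 : 0 < K by rewrite mulr_gt0// addr_gt0// mulr_gt0.
near=> y.
have yz : enorm (y - z) < e / K by near: y; apply: near_enorm_lt; rewrite divr_gt0.
rewrite dotvZl; have -> : gamma^-1 = 2 * k by rewrite /k; field; rewrite gt_eqF.
apply: (@le_trans _ _ (K * enorm (y - z) ^+ 2)); last first.
  rewrite expr2 mulrA ler_wpM2r ?enorm_ge0// mulrC -ler_pdivlMr// ltW//.
have h1 := moreau_le y z; have h2 := moreau_le z y.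
rewrite /= [in X in X <= _]moreauE /= in h1.
rewrite /= [in X in X <= _]moreauE /= in h2.
rewrite /= [moreau gamma xi z]moreauE [moreau gamma xi y]moreauE /=.
have cross : `|dotv (p y - p z) (y - z)| <= k / kappa * enorm (y - z) ^+ 2.
  apply: le_trans (normr_dotv_le _ _) _.
  by rewrite expr2 mulrA ler_wpM2r ?enorm_ge0// prox_lipschitz.
exact: (envelope_arith k_gt0 (sqr_ge0 _) h1 h2
  (sqr_dist_exchange _ _ _ _) (sqr_dist_shift _ _ _) cross).
Unshelve. all: by end_near. Qed.

(** Fermat's rule for the penalized function at its minimizer. *)
Lemma prox_stationary z a :
  (\forall y \near p z, xi y \is a fin_num) ->
  has_grad (fine \o xi) (p z) a -> p z + gamma *: a = z.
Proof.
move=> xifin xia.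
have objd := has_gradD xia (has_gradZ k (has_grad_sqr_dist z (p z))).
have /(local_min_has_grad objd) : \forall y \near p z,
    fine (xi (p z)) + k * dotv (p z - z) (p z - z) <=
    fine (xi y) + k * dotv (y - z) (y - z).
  near=> y; have yfin : xi y \is a fin_num by near: y.
  have := prox_argmin z y.
  by rewrite !obj_fin ?prox_fin// lee_fin !enorm_sqr.
rewrite scalerA => /(congr1 (fun v => gamma *: v)).
rewrite scalerDr scalerA scaler0 (_ : gamma * (k * 2) = 1) ?scale1r.
  by rewrite addrA => /eqP; rewrite subr_eq0 addrC => /eqP.
by rewrite /k; field; rewrite gt_eqF.
Unshelve. all: by end_near. Qed.

End Prox.

(** * Derivative of the proximal mapping *)

Section ProxDerivatives.
Context {R : realType}.

Lemma lt_inve_mul (t r : R) : 0 < t -> (t%:E < (r%:E)^-1)%E -> t * r < 1.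
Proof.
move=> t0; have [->|r0] := eqVneq r 0; first by rewrite mulr0 ltr01.
rewrite inver (negPf r0) lte_fin => tr.
have : 0 < r by rewrite -invr_gt0 (lt_trans t0).
by move=> rp; rewrite -ltr_pdivlMr// mul1r.
Qed.

Lemma lipschitz_proximable n (g : 'rV[R]_n -> R) M t :
  lipschitz_differentiable M g -> 0 < t -> t * M < 1 ->
  proximable t M (EFin \o g).
Proof.
move=> gM t0 tM; have [M0 dg _] := gM; have low := descent gM.
have Mt : M / 2 < (2 * t)^-1.
  rewrite invfM [ltRHS]mulrC ltr_pM2r ?invr_gt0// -[t^-1]mul1r.
  by rewrite ltr_pdivlMr// mulrC.
split=> //.
- by split=> [x|]; [exact: ltNyr|exists 0; exact: ltry].
- move=> x a; rewrite lte_fin => ax.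
  have cg : {for x, continuous g} by exact: differentiable_continuous (dg x).
  by exists [set y | a < g y]; first exact: (cg _ (lt_nbhsr ax)).
- move=> x y s /andP[s0 s1]; rewrite /= -!EFinD lee_fin.
  set w := s *: x + (1 - s) *: y.
  have wx : x - w = (1 - s) *: (x - y).
    by rewrite /w; apply/rowP => i; rewrite !mxE; ring.
  have wy : y - w = (- s) *: (x - y).
    by rewrite /w; apply/rowP => i; rewrite !mxE; ring.
  have sq : enorm w ^+ 2 = s * enorm x ^+ 2 + (1 - s) * enorm y ^+ 2
      - s * (1 - s) * dotv (x - y) (x - y).
    by rewrite /w !enorm_sqr !dotv_lin (dotvC y x); ring.
  rewrite sq.
  have := low w x; have := low w y; rewrite wx wy !dotvZl !dotvZr.
  move: (g x) (g y) (g w) (dotv _ _) (dotv _ _) => a b c d e.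
  move: (enorm x ^+ 2) (enorm y ^+ 2) => X Y h1 h2.
  have := ler_wpM2l s0 h2; have : 0 <= 1 - s by lra.
  move=> /ler_wpM2l/(_ _ _ h1).
  by nra.
exists ((M / 2 + (2 * t)^-1) / 2); first by lra.
set a := (M / 2 + (2 * t)^-1) / 2.
have aM : 0 < a - M / 2 by rewrite /a; lra.
exists (g 0 - enorm (grad g 0) ^+ 2 / (4 * (a - M / 2))) => x.
rewrite -EFinD lee_fin.
have := low 0 x; rewrite subr0 -enorm_sqr.
have := normr_dotv_le (grad g 0) x; rewrite ler_norml => /andP[+ _].
have : 0 <= (a - M / 2) * (enorm x - enorm (grad g 0) / (2 * (a - M / 2))) ^+ 2.
  by rewrite mulr_ge0 ?sqr_ge0// ltW.
rewrite complete_square ?gt_eqF//=.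
move: (enorm (grad g 0) ^+ 2 / _) (enorm (grad g 0) * _) (g 0) (g x) (dotv _ _).
move: (enorm x ^+ 2) (a) => X b p q r s u.
by lra.
Qed.

Lemma qform_pert_gt0 n (A : 'M[R]_n) t c :
  (forall u, enorm (u *m A) <= c * enorm u) -> `|t| * c < 1 ->
  forall u, u != 0 -> 0 < qform (1%:M + t *: A) u.
Proof.
move=> Ac tc u u0; rewrite /qform mulmxDr mulmx1 -scalemxAr dotvDl dotvZl.
have uu : 0 < dotv u u by rewrite dotvv_gt0.
have h : `|t * dotv (u *m A) u| <= `|t| * c * dotv u u.
  rewrite normrM -mulrA ler_wpM2l// (le_trans (normr_dotv_le _ _))//.
  by rewrite -enorm_sqr expr2 mulrA ler_wpM2r ?enorm_ge0.
have : `|t| * c * dotv u u < dotv u u by rewrite -[ltRHS]mul1r ltr_pM2r.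
by move: h; rewrite ler_norml => /andP[h _]; move: h; rewrite lerNl; lra.
Qed.

Lemma continuous_pert_at n m (C : 'rV[R]_n -> 'M[R]_m) x t :
  {for x, continuous C} -> {for x, continuous (fun y => 1%:M + t *: C y)}.
Proof.
move=> cC.
apply: (@continuousD _ _ _ (cst 1%:M) (fun y => t *: C y)).
  exact: cst_continuous.
exact: (@cvgZ _ _ _ _ _ (cst t) C t (C x) (cvg_cst t) cC).
Qed.

(** Where xi is smooth, the stationarity equation says that
    u + gamma grad xi u inverts the proximal mapping. *)
Lemma has_jac_prox n (gamma beta : R) (xi : 'rV[R]_n -> \bar R) z :
  0 < gamma -> proximable gamma beta xi ->
  finite_near xi (prox gamma xi z) ->
  twice_differentiable_at (fine \o xi) (prox gamma xi z) ->
  1%:M + gamma *: hessian (fine \o xi) (prox gamma xi z) \in unitmx ->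
  has_jac (prox gamma xi) z
    (invmx (1%:M + gamma *: hessian (fine \o xi) (prox gamma xi z))).
Proof.
move=> g0 xiP xifin [dxi d2xi] uN.
have lip y := prox_lipschitz g0 xiP y z.
apply: (has_jac_inverse (T := fun u => u + gamma *: grad (fine \o xi) u) _ uN lip).
  by apply: has_jacD; [exact: has_jac_id|exact/has_jacZ/has_jac_diff].
have cP := lipschitz_continuous_at lip.
near=> y; apply: (prox_stationary g0 xiP).
  near: y; exact: (cP _ (nbhs_interior xifin)).
apply: has_grad_diff; near: y; exact: (cP _ dxi).
Unshelve. all: by end_near. Qed.

End ProxDerivatives.

(** * The forward-backward envelope *)

Section ForwardBackward.
Context {R : realType} {n : nat}.
Variables (gamma beta : R) (f : 'rV[R]_n -> \bar R) (S : 'rV[R]_n -> R).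
Hypotheses (gamma_gt0 : 0 < gamma) (f_prox : proximable gamma beta f).
Hypotheses (S_C2 : C2_on setT S).

Definition fbe x : R :=
  S x - gamma / 2 * enorm (grad S x) ^+ 2 +
  fine (moreau gamma f (x - gamma *: grad S x)).

(** The residual of the fixed point equation of forward-backward splitting. *)
Definition fb_residual x : 'rV[R]_n :=
  gamma^-1 *: (x - prox gamma f (x - gamma *: grad S x)).

(** The Jacobian matrix of the forward step. *)
Definition forward_jac x : 'M[R]_n := 1%:M - gamma *: hessian S x.

Let dS x : has_grad S x (grad S x).
Proof. by have [[/nbhs_singleton/has_grad_diff]] := S_C2 (I : setT x). Qed.

Let d2S x : has_jac (grad S) x (hessian S x).
Proof. by have [[_ /has_jac_diff]] := S_C2 (I : setT x). Qed.

Lemma forward_jac_sym x : (forward_jac x)^T = forward_jac x.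
Proof.
have [d2 _] := S_C2 (I : setT x).
by rewrite /forward_jac linearB /= linearZ /= trmx1 hessian_sym.
Qed.

Let dforward x : has_jac (fun y => y - gamma *: grad S y) x (forward_jac x).
Proof. by apply: has_jacB; [exact: has_jac_id|exact/has_jacZ/d2S]. Qed.

Lemma has_grad_fbe x : has_grad fbe x (fb_residual x *m forward_jac x).
Proof.
have de := has_grad_comp (dforward x)
  (has_grad_moreau gamma_gt0 f_prox (x - gamma *: grad S x)).
have dq := has_gradZ (gamma / 2) (has_grad_comp (d2S x) (has_grad_sqr (grad S x))).
have := has_gradD (has_gradB (dS x) dq) de.
rewrite (_ : (fun y => _) = fbe); last first.
  by apply/funext => y; rewrite /fbe enorm_sqr.
rewrite (_ : _ + _ = fb_residual x *m forward_jac x)//.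
have sH : (hessian S x)^T = hessian S x.
  by have [d2 _] := S_C2 (I : setT x); exact: hessian_sym.
rewrite forward_jac_sym sH /fb_residual.
set w := prox _ _ _; set s := grad S x; set H := hessian S x.
have -> : x - gamma *: s - w = (x - w) - gamma *: s by rewrite addrAC.
rewrite scalerBr scalerA mulVf ?gt_eqF// scale1r mulmxBl.
rewrite [s *m forward_jac x]mulmxBr mulmx1 -scalemxAr -scalemxAl !scalerA.
have -> : gamma / 2 * 2 = gamma by field.
by rewrite addrC subrK.
Qed.

Lemma has_jac_fb_residual p (N := 1%:M + gamma *: hessian (fine \o f) p) :
  fb_residual p = 0 -> finite_near f p -> twice_differentiable_at (fine \o f) p ->
  N \in unitmx ->
  has_jac fb_residual p (gamma^-1 *: (1%:M - forward_jac p *m invmx N)).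
Proof.
move=> rp0 fp d2f uN.
have wp : prox gamma f (p - gamma *: grad S p) = p.
  apply/esym/eqP; rewrite -subr_eq0.
  by move/eqP: rp0; rewrite scaler_eq0 invr_eq0 gt_eqF.
have dprox : has_jac (prox gamma f) (p - gamma *: grad S p) (invmx N).
  by have := @has_jac_prox R n gamma beta f (p - gamma *: grad S p); rewrite wp; apply.
by apply/has_jacZ/has_jacB; [exact: has_jac_id|exact: (has_jac_comp (dforward p) dprox)].
Qed.

End ForwardBackward.

(** * The composite smooth part *)

Section SmoothPart.
Context {R : realType} {n m : nat}.
Variables (L : {linear 'rV[R]_n -> 'rV[R]_m}).
Variables (g : 'rV[R]_n -> R) (h : 'rV[R]_m -> R).

Lemma continuous_mulmx_at p q r s (A : 'M[R]_(p, q)) (B : 'M[R]_(r, s))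
    (C : 'rV[R]_n -> 'M[R]_(q, r)) x :
  {for x, continuous C} -> {for x, continuous (fun y => A *m C y *m B)}.
Proof.
move=> cC; apply/(@cvgrPdist_lt _ _ _ (nbhs x)) => e e0.
pose K : R := q%:R * (r%:R * (`|A| * `|B|)) + 1.
have K0 : 0 < K by rewrite ltr_wpDl// !mulr_ge0.
near=> y; rewrite -mulmxBl -mulmxBr.
apply: (@le_lt_trans _ _ (K * `|C x - C y|)).
  rewrite [leLHS]/Num.norm /= mx_normrE; apply: bigmax_le => [|[i j] _ /=].
    by rewrite mulr_ge0// ltW.
  rewrite mxE; apply: le_trans (ler_norm_sum _ _ _) _.
  apply: (@le_trans _ _ (\sum_(k < r) (q%:R * `|A| * `|B| * `|C x - C y|))).
    apply: ler_sum => k _; rewrite normrM mxE.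
    apply: (@le_trans _ _ ((\sum_(l < q) `|A| * `|C x - C y|) * `|B|)).
      rewrite ler_pM ?mx_norm_coord//; apply: le_trans (ler_norm_sum _ _ _) _.
      by apply: ler_sum => l _; rewrite normrM ler_pM ?mx_norm_coord.
    rewrite sumr_const card_ord -mulr_natl le_eqVlt; apply/orP; left; apply/eqP.
    by ring.
  rewrite sumr_const card_ord -mulr_natl /K mulrDl mul1r.
  apply: (@le_trans _ _ (q%:R * (r%:R * (`|A| * `|B|)) * `|C x - C y|)).
    by rewrite le_eqVlt; apply/orP; left; apply/eqP; ring.
  by rewrite lerDl.
rewrite mulrC -ltr_pdivlMr//; near: y.
by apply: cvgr_dist_lt; [exact: cC|rewrite divr_gt0].
Unshelve. all: by end_near. Qed.

Let S x := g x + h (L x).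

Let LE : L = mulmxr (lin1_mx L) :> ('rV[R]_n -> 'rV[R]_m).
Proof. by apply/funext => u /=; rewrite mul_rV_lin1. Qed.

Let dL x : has_jac L x (lin1_mx L).
Proof. by rewrite [X in has_jac X]LE; exact: has_jac_mulmx. Qed.

Lemma has_grad_smooth x : differentiable g x -> differentiable h (L x) ->
  has_grad S x (grad g x + adjoint L (grad h (L x))).
Proof.
move=> dg dh; apply: has_gradD; first exact: has_grad_diff.
exact: has_grad_comp (dL x) (has_grad_diff dh).
Qed.

Lemma lipschitz_differentiable_smooth Lg Lh :
  lipschitz_differentiable Lg g -> lipschitz_differentiable Lh h ->
  lipschitz_differentiable (Lg + Lh * opnorm L ^+ 2) S.
Proof.
move=> [Lg0 dg lg] [Lh0 dh lh].
split=> [|x|x y]; first by rewrite addr_ge0// mulr_ge0// sqr_ge0.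
  by have [] := has_grad_smooth (dg x) (dh (L x)).
rewrite (has_gradE (has_grad_smooth (dg x) (dh (L x)))).
rewrite (has_gradE (has_grad_smooth (dg y) (dh (L y)))).
rewrite opprD addrACA mulrDl; apply: le_trans (enormD _ _) _; apply: lerD => //.
rewrite /adjoint -mulmxBl -/(adjoint L _); apply: le_trans (enorm_adjoint_le _ _) _.
have -> : Lh * opnorm L ^+ 2 * enorm (x - y) =
    opnorm L * (Lh * (opnorm L * enorm (x - y))) by ring.
rewrite ler_wpM2l ?opnorm_ge0//; apply: le_trans (lh _ _) _.
by rewrite ler_wpM2l// -linearB opnorm_ub.
Qed.

Lemma C2_smooth : C2_on setT g -> C2_on setT h -> C2_on setT S.
Proof.
move=> g2 h2.
have dg x : differentiable g x by have [[/nbhs_singleton]] := g2 x I.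
have dh x : differentiable h x by have [[/nbhs_singleton]] := h2 x I.
have gradS : grad S = fun x => grad g x + grad h (L x) *m (lin1_mx L)^T.
  by apply/funext => x; exact: has_gradE (has_grad_smooth (dg x) (dh (L x))).
have d2S x : has_jac (grad S) x
    (hessian g x + lin1_mx L *m (hessian h (L x) *m (lin1_mx L)^T)).
  have [[_ /has_jac_diff d2g] _] := g2 x I.
  have [[_ /has_jac_diff d2h] _] := h2 (L x) I.
  rewrite gradS; apply: has_jacD => //.
  exact: has_jac_comp (dL x) (has_jac_comp d2h (has_jac_mulmx _ _)).
move=> x _; split.
  split; last by have [] := d2S x.
  by near=> y; have [] := has_grad_smooth (dg y) (dh (L y)).
have -> : hessian S = fun y =>
    hessian g y + lin1_mx L *m (hessian h (L y) *m (lin1_mx L)^T).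
  by apply/funext => y; exact: has_jacE.
have [_ cg] := g2 x I; have [_ ch] := h2 (L x) I.
have cL := has_jac_continuous (dL x).
apply: (cvgD cg); under eq_fun do rewrite mulmxA; rewrite mulmxA.
have ChL := @continuous_comp _ _ _ L (hessian h) x cL ch.
exact: (continuous_mulmx_at (A := lin1_mx L) (B := (lin1_mx L)^T) ChL).
Unshelve. all: by end_near. Qed.

End SmoothPart.

(** * The envelope and the objective *)

(** The growth bound is required for constants slightly larger than gamma; this
    is the gap that makes the proximal problem coercive. *)
Lemma proximable_nonsmooth (R : realType) n (gamma beta ell : R)
    (f : 'rV[R]_n -> \bar R) :
  proper f -> lower_semicontinuous f -> weakly_convex beta f ->
  0 < gamma -> gamma * beta < 1 -> 0 <= ell -> gamma * ell < 1 ->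
  (forall t : R, 0 < t -> (t%:E < (ell%:E)^-1)%E ->
     bounded_below (fun x => (f x + ((2 * t)^-1 * enorm x ^+ 2)%:E)%E)) ->
  proximable gamma beta f.
Proof.
move=> pf lf wf g0 gb ell0 gl bf; split=> //.
  rewrite invfM [ltRHS]mulrC ltr_pM2r ?invr_gt0// -[gamma^-1]mul1r.
  by rewrite ltr_pdivlMr// mulrC.
have [t gt tl] : exists2 t, gamma < t & (t%:E < (ell%:E)^-1)%E.
  have [->|l0] := eqVneq ell 0.
    by exists (gamma + 1); rewrite ?ltrDl// inve0 ltry.
  have lp : 0 < ell by rewrite lt0r l0.
  have gle : gamma < ell^-1 by rewrite -[ell^-1]mul1r ltr_pdivlMr.
  exists ((gamma + ell^-1) / 2); first by lra.
  by rewrite inver (negPf l0) lte_fin; lra.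
have t0 := lt_trans g0 gt.
exists (2 * t)^-1; last exact: bf.
by rewrite ltf_pV2 ?posrE ?mulr_gt0// ltr_pM2l.
Qed.

Section EnvelopeReduction.
Context {R : realType} {n m : nat}.
Variables (L : {linear 'rV[R]_n -> 'rV[R]_m}) (f : 'rV[R]_n -> \bar R).
Variables (g : 'rV[R]_n -> R) (h : 'rV[R]_m -> R) (gamma betag betaf : R).
Hypotheses (gamma_gt0 : 0 < gamma).
Hypotheses (g_prox : proximable gamma betag (EFin \o g)).
Hypotheses (f_prox : proximable gamma betaf f).
Hypotheses (dg : forall x, differentiable g x) (dh : forall x, differentiable h x).

Local Notation P := (prox gamma (EFin \o g)).

Lemma prox_smoothE z : P z + gamma *: grad g (P z) = z.
Proof.
apply: (prox_stationary gamma_gt0 g_prox); first by apply: filterE.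
exact: (has_grad_diff (dg (P z))).
Qed.

Let dmoreau z : grad (fine \o moreau gamma (EFin \o g)) z = grad g (P z).
Proof.
rewrite (has_gradE (has_grad_moreau gamma_gt0 g_prox z)).
rewrite -{1}(prox_smoothE z) [P z + _]addrC addrK scalerA mulVf ?scale1r//.
by rewrite gt_eqF.
Qed.

(** The terms of the envelope in grad g and in the adjoint of grad h complete the
    square of grad S. *)
Lemma envelope_fbe z : envelope f g h L gamma z =
  (fbe gamma f (fun x => g x + h (L x)) (P z))%:E.
Proof.
set S := fun x => g x + h (L x).
have gradS x : grad S x = grad g x + adjoint L (grad h (L x)).
  exact: has_gradE (has_grad_smooth (dg x) (dh (L x))).
have mfin w : moreau gamma f w = (fine (moreau gamma f w))%:E.
  by rewrite (moreauE gamma_gt0 f_prox).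
have Pzz : P z - z = - (gamma *: grad g (P z)).
  by rewrite -{2}(prox_smoothE z) opprD addrA subrr add0r.
have argE : z - (2 * gamma) *: grad g (P z) - gamma *: adjoint L (grad h (L (P z)))
    = P z - gamma *: grad S (P z).
  have arith (p d q : 'rV[R]_n) : p + gamma *: d - (2 * gamma) *: d - gamma *: q
      = p - gamma *: (d + q) by apply/rowP => i; rewrite !mxE; ring.
  by rewrite gradS -arith prox_smoothE.
have quadE (d q : 'rV[R]_n) : (2 * gamma)^-1 * enorm (- (gamma *: d)) ^+ 2
    + (- gamma * enorm d ^+ 2 - gamma * dotv q d - gamma / 2 * enorm q ^+ 2)
    = - (gamma / 2 * enorm (d + q) ^+ 2).
  by rewrite !enorm_sqr !dotv_lin (dotvC q d); field; rewrite gt_eqF.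
rewrite /envelope dmoreau (moreauE gamma_gt0 g_prox) argE Pzz.
rewrite mfin -!EFinD; congr EFin.
rewrite /fbe gradS; congr (_ + _); rewrite -quadE /S /=; ring.
Qed.

End EnvelopeReduction.

(** Differentiability at a point is local, and near p both summands are finite. *)
Lemma second_order_sum (R : realType) n (f : 'rV[R]_n -> \bar R) (S : 'rV[R]_n -> R)
    p (psi := fun x => (f x + (S x)%:E)%E) :
  finite_near f p -> twice_differentiable_at (fine \o f) p -> C2_on setT S ->
  [/\ finite_near psi p, twice_differentiable_at (fine \o psi) p,
      grad (fine \o psi) p = grad (fine \o f) p + grad S p &
      hessian (fine \o psi) p = hessian (fine \o f) p + hessian S p].
Proof.
move=> ffin [df d2f] S_C2.
have psiE : \forall y \near p, fine (f y) + S y = fine (psi y).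
  by near=> y; rewrite /psi fineD//; near: y; exact: ffin.
have psifin : finite_near psi p.
  by near=> y; rewrite /psi fin_numD /= andbT; near: y; exact: ffin.
have dS y : has_grad S y (grad S y).
  by have [[/nbhs_singleton/has_grad_diff]] := S_C2 y I.
have dpsi : \forall y \near p, has_grad (fine \o psi) y
    (grad (fine \o f) y + grad S y).
  near=> y; apply: (near_eq_has_grad (f := fun y => fine (f y) + S y)).
    by near: y; exact: nbhs_interior psiE.
  apply: has_gradD (dS y); apply: has_grad_diff.
  by near: y; exact: df.
have gradpsi : \forall y \near p,
    grad (fine \o f) y + grad S y = grad (fine \o psi) y.
  by near=> y; apply/esym/has_gradE; near: y; exact: dpsi.
have d2psi : has_jac (grad (fine \o psi)) p (hessian (fine \o f) p + hessian S p).
  apply: near_eq_has_jac gradpsi _; apply: has_jacD; first exact: has_jac_diff.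
  by have [[_ /has_jac_diff]] := S_C2 p I.
split=> //; last exact: has_jacE.
  by split; [apply: filterS dpsi => y []|have [] := d2psi].
by rewrite (nbhs_singleton gradpsi).
Unshelve. all: by end_near. Qed.

Theorem theorem9 (R : realType) (n m : nat)
  (L : {linear 'rV[R]_n -> 'rV[R]_m})
  (f : 'rV[R]_n -> \bar R) (g : 'rV[R]_n -> R) (h : 'rV[R]_m -> R)
  (Lg Lh Lf betaf gamma : R) (zs : 'rV[R]_n)
  (g_lip : lipschitz_differentiable Lg g)
  (h_lip : lipschitz_differentiable Lh h)
  (f_proper : proper f)
  (f_lsc : lower_semicontinuous f)
  (gamma_gt0 : 0 < gamma)
  (gamma_lt : (gamma%:E < ((Lg + Lh * opnorm L ^+ 2)%:E)^-1)%E)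
  (f_bounded : forall gamma' : R, 0 < gamma' ->
     (gamma'%:E < ((Lg + Lh * opnorm L ^+ 2)%:E)^-1)%E ->
     bounded_below (fun x => (f x + ((2 * gamma')^-1 * enorm x ^+ 2)%:E)%E))
  (f_wconvex : weakly_convex betaf f)
  (gamma_ltbf : (gamma%:E < (betaf%:E)^-1)%E)
  (g_C2 : C2_on setT g)
  (h_C2 : C2_on setT h)
  (Lf_gt0 : 0 < Lf)
  (gamma_ltLf : gamma < Lf^-1)
  (f_C2 : forall z : 'rV[R]_n, critical_point (envelope f g h L gamma) z ->
     let p := prox gamma (EFin \o g) z in
     C2_near f p /\ opnorm (mulmxr (hessian (fine \o f) p)) <= Lf)
  (zs_crit : critical_point (envelope f g h L gamma) zs) :
  h = cst 0 \/ g = cst 0 ->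
  (strict_saddle (envelope f g h L gamma) zs <->
   strict_saddle (objective f g h L) (prox gamma (EFin \o g) zs)).
Proof.
move=> _.
have [[U [oU Up] [Ufin fC2]] fLf] := f_C2 zs zs_crit.
pose P := prox gamma (EFin \o g).
pose S x := g x + h (L x).
pose ell := Lg + Lh * opnorm L ^+ 2.
have [Lg0 dg _] := g_lip; have [Lh0 dh _] := h_lip.
have S_lip : lipschitz_differentiable ell S by exact: lipschitz_differentiable_smooth.
have S_C2 : C2_on setT S by exact: C2_smooth.
have ell0 : 0 <= ell by have [] := S_lip.
have gell : gamma * ell < 1 by exact: lt_inve_mul.
have gLg : gamma * Lg < 1.
  apply: le_lt_trans gell; rewrite ler_pM2l// lerDl.
  by rewrite mulr_ge0// sqr_ge0.
have g_prox : proximable gamma Lg (EFin \o g) by exact: lipschitz_proximable.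
have f_prox : proximable gamma betaf f.
  by apply: proximable_nonsmooth f_bounded => //; exact: lt_inve_mul.
have d2g x : has_jac (grad g) x (hessian g x).
  by have [[_ /has_jac_diff]] := g_C2 x I.
have d2S x : has_jac (grad S) x (hessian S x).
  by have [[_ /has_jac_diff]] := S_C2 x I.
pose Phi := fbe gamma f S.
have envE z : envelope f g h L gamma z = (Phi (P z))%:E.
  exact: (envelope_fbe L gamma_gt0 g_prox f_prox dg dh).
have envfin z : envelope f g h L gamma z \is a fin_num by rewrite envE.
have fenvE : fine \o envelope f g h L gamma = Phi \o P.
  by apply/funext => z /=; rewrite envE.
(* J and N are the Jacobian matrices of the inverses of the proximal mappings of
   g and f, and M is that of the forward step *)
pose J z := 1%:M + gamma *: hessian g (P z).
pose M := forward_jac gamma S.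
pose p := P zs.
pose B := hessian (fine \o f) p.
pose N := 1%:M + gamma *: B.
have Jpos z u : u != 0 -> 0 < qform (J z) u.
  apply: (@qform_pert_gt0 _ _ _ _ Lg); last by rewrite gtr0_norm.
  move=> v; apply: (has_jac_lipschitz_le (d2g (P z))) => y.
  by have [_ _] := g_lip.
have Mpos z u : u != 0 -> 0 < qform (M z) u.
  rewrite /M /forward_jac -scaleNr.
  apply: (@qform_pert_gt0 _ _ _ _ ell); last by rewrite normrN gtr0_norm.
  move=> v; apply: (has_jac_lipschitz_le (d2S z)) => y.
  by have [_ _] := S_lip.
have Npos u : u != 0 -> 0 < qform N u.
  apply: (@qform_pert_gt0 _ _ _ _ Lf).
    move=> v; apply: le_trans (opnorm_ub (mulmxr B) v) _.
    by rewrite ler_wpM2r ?enorm_ge0.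
  by rewrite gtr0_norm// -ltr_pdivlMr// mul1r.
have uJ z := qform_unit (Jpos z).
have uM z := qform_unit (Mpos z).
have uN := qform_unit Npos.
have [d2fp _] := fC2 p Up.
have ffin : finite_near f p.
  by apply: filterS Ufin _; exact: open_nbhs_nbhs.
have Jsym z : (J z)^T = J z.
  have [d2 _] := g_C2 (P z) I.
  by rewrite /J linearD /= linearZ /= trmx1 hessian_sym.
have Nsym : N^T = N by rewrite /N linearD /= linearZ /= trmx1 hessian_sym.
have Msym := forward_jac_sym gamma S_C2.
have dP z : has_jac P z (invmx (J z)).
  have gE : fine \o (EFin \o g) = g by [].
  have [g2 _] := g_C2 (P z) I.
  have gfin : finite_near (EFin \o g) (P z) by exact: filterE.
  have := has_jac_prox gamma_gt0 g_prox gfin; rewrite gE; apply; first exact: g2.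
  exact: uJ.
pose G := fb_residual gamma f S.
have denv z : has_grad (fine \o envelope f g h L gamma) z
    (G (P z) *m M (P z) *m invmx (J z)).
  rewrite fenvE -[in invmx _]Jsym -trmx_inv.
  exact: (has_grad_comp (dP z) (has_grad_fbe gamma_gt0 f_prox S_C2 (P z))).
have gradenv z : grad (fine \o envelope f g h L gamma) z *m J z = G (P z) *m M (P z).
  rewrite (has_gradE (denv z)); exact: (mulmxKV (uJ z)).
have Gp0 : G p = 0.
  have [_ _ env0] := zs_crit; have := gradenv zs; rewrite env0 mul0mx => /esym.
  by move=> /(congr1 (mulmx^~ (invmx (M p)))); rewrite (mulmxK (uM p)) mul0mx.
have dG : has_jac G p (gamma^-1 *: (1%:M - M p *m invmx N)).
  exact: (has_jac_fb_residual gamma_gt0 f_prox S_C2 Gp0 ffin d2fp uN).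
have cP : {for zs, continuous P} by exact: has_jac_continuous (dP zs).
have cM : {for p, continuous M}.
  have [_ cH] := S_C2 p I.
  rewrite (_ : M = fun y => 1%:M + (- gamma) *: hessian S y).
    exact: continuous_pert_at.
  by apply/funext => y; rewrite scaleNr.
have cJ : {for zs, continuous J}.
  have [_ cH] := g_C2 p I.
  have cHP := @continuous_comp _ _ _ P (hessian g) zs cP cH.
  exact: (@continuous_pert_at _ _ _ (hessian g \o P) zs gamma cHP).
have dGM : has_jac (fun z => G (P z) *m M (P z)) zs
    (invmx (J zs) *m (gamma^-1 *: (1%:M - M p *m invmx N)) *m M p).
  apply: (@has_jac_mulmx0 _ _ _ _ (G \o P) (M \o P)).
  - exact: Gp0.
  - exact: has_jac_comp (dP zs) dG.
  - exact: (continuous_comp cP cM).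
have d2env : has_jac (grad (fine \o envelope f g h L gamma)) zs
    (invmx (J zs) *m (gamma^-1 *: (1%:M - M p *m invmx N)) *m M p *m invmx (J zs)).
  by apply: (has_jac_divmx0 gradenv (uJ zs) _ dGM cJ); rewrite -/p Gp0 mul0mx.
have twice_env : twice_differentiable_at (fine \o envelope f g h L gamma) zs.
  by split; [apply: filterE => z; have [] := denv z|have [] := d2env].
have hessenv : hessian (fine \o envelope f g h L gamma) zs = gamma^-1 *:
    (invmx (J zs) *m (M p - M p *m invmx N *m M p) *m (invmx (J zs))^T).
  have arith (K A C : 'M[R]_n) : K *m (gamma^-1 *: (1%:M - A)) *m C *m K =
      gamma^-1 *: (K *m (C - A *m C) *m K).
    by rewrite -scalemxAr -!scalemxAl -(mulmxA K _ C) [(1%:M - A) *m C]mulmxBl mul1mx.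
  by rewrite /hessian (has_jacE d2env) trmx_inv Jsym arith.
have gi0 : 0 < gamma^-1 by rewrite invr_gt0.
have qscale (A : 'M[R]_n) :
    (exists u, qform (gamma^-1 *: A) u < 0) <-> (exists u, qform A u < 0).
  by split=> -[u qu]; exists u; move: qu; rewrite qformZ pmulr_rlt0.
have ufin : finite_near (envelope f g h L gamma) zs by exact: filterE.
have envP : strict_saddle (envelope f g h L gamma) zs <->
    exists u, qform (M p - M p *m invmx N *m M p) u < 0.
  have uK : invmx (J zs) \in unitmx by rewrite unitmx_inv; exact: uJ.
  apply: iff_trans (qform_congr_lt0 _ uK); apply: iff_trans (qscale _).
  rewrite -hessenv; apply: iff_trans (lambda_min_lt0 (hessian_sym twice_env)).
  by split=> [[_ _ _]|lmin].
have objE : objective f g h L = fun x => (f x + (S x)%:E)%E.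
  by apply/funext => x; rewrite /objective -addeA -EFinD.
have [objfin twice_obj gradobj hessobj0] := second_order_sum ffin d2fp S_C2.
rewrite -objE in objfin twice_obj gradobj hessobj0.
have hessobj : hessian (fine \o objective f g h L) p = gamma^-1 *: (N - M p).
  have arith (A C : 'M[R]_n) :
      1%:M + gamma *: A - (1%:M - gamma *: C) = gamma *: (A + C).
    by rewrite scalerDr opprB [1%:M + _]addrC addrACA subrr addr0.
  rewrite [N - _](arith B (hessian S p)).
  by rewrite scalerA mulVf ?scale1r ?gt_eqF// hessobj0.
have critobj : critical_point (objective f g h L) p.
  split=> //; first by have /nbhs_singleton := twice_obj.1.
  rewrite gradobj.
  have wp : prox gamma f (p - gamma *: grad S p) = p.
    apply/esym/eqP; rewrite -subr_eq0; move/eqP: Gp0.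
    by rewrite scaler_eq0 invr_eq0 gt_eqF.
  have := @prox_stationary R n gamma betaf f gamma_gt0 f_prox (p - gamma *: grad S p).
  rewrite wp => /(_ _ ffin (has_grad_diff (nbhs_singleton d2fp.1))) /addrI/eqP.
  by rewrite -addr_eq0 -scalerDr scaler_eq0 gt_eqF//= => /eqP.
have objP : strict_saddle (objective f g h L) p <->
    exists u, qform (N - M p) u < 0.
  apply: iff_trans (qscale _).
  rewrite -hessobj; apply: iff_trans (lambda_min_lt0 (hessian_sym twice_obj)).
  by split=> [[_ _ _]|lmin].
apply: iff_trans envP (iff_trans _ (iff_sym objP)).
exact: schur_qform_lt0 (Msym p) Nsym (Mpos p) Npos.
Qed.
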